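(* Let $k\ge5$ be an integer. For all sufficiently large admissible $n$, a planar $k$-uniform hypergraph on $n$ vertices has maximum spectral radius (among all planar $k$-uniform hypergraphs on $n$ vertices) if and only if it is (up to isomorphism) the face hypergraph of a balanced theta graph.
   Context: For an integer $k\ge3$, a closed $k$-angulation is a simple $2$-connected plane graph all of whose faces, the outer face included, are bounded by cycles of length $k$; on $n$ vertices it has $2(n-2)/(k-2)$ faces. Its face hypergraph is the $k$-uniform hypergraph on its vertex set whose edges are the vertex sets of all its faces. For $k\ge4$, a $k$-uniform hypergraph is planar if it is the face hypergraph of a closed $k$-angulation. An integer $n\ge k$ is admissible if $2(n-2)/(k-2)$ is an integer. For integers $t\ge3$ and $p_1,\dots,p_t\ge1$ with $p_i+p_{i+1}=k-2$ for all $i$ (indices modulo $t$), $\Theta(p_1,\dots,p_t)$ is the plane graph in which two (branch) vertices are joined by $t$ internally disjoint paths with $p_1,\dots,p_t$ internal vertices, in this cyclic order. Each of its $t$ faces is a $k$-cycle through both branch vertices, it has $n=2+\frac t2(k-2)$ vertices, and $t=2(n-2)/(k-2)$. Such a graph is called a balanced theta graph. The spectral radius of a $k$-uniform hypergraph $\mathcal H$ on $n$ vertices is $$\lambda(\mathcal H)=\max\Bigl\{P_{\mathcal H}(x): x\in\mathbb R_{\ge0}^n,\ \sum_v x_v^k=1\Bigr\},\qquad P_{\mathcal H}(x)=k\sum_{e\in E(\mathcal H)}\prod_{v\in e}x_v .$$ *)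

(* Defs.v *)
From HB Require Import structures.
From mathcomp Require Import all_boot all_order all_algebra.
From mathcomp Require Import all_classical all_reals all_analysis.

Set Implicit Arguments.
Unset Strict Implicit.
Unset Printing Implicit Defensive.

Import Order.TTheory GRing.Theory Num.Theory.
Import numFieldNormedType.Exports.

(* A graph drawn on an oriented surface, up to homeomorphism: an adjacency
   relation together with, for each adjacent pair (x, y), the neighbour
   [rot x y] that follows y in the cyclic order around x.  The values of
   [rot x y] for non-adjacent x and y are irrelevant. *)
Record embedding (V : finType) := Embedding {
  adj : rel V;
  rot : V -> V -> V
}.

Section Embedding.
Variables (V : finType) (G : embedding V).

Definition simple_graph : Prop := symmetric (adj G) /\ irreflexive (adj G).

(* [rot G x] permutes the neighbours of x in a single cycle. *)
Definition rotation_system : Prop :=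
  forall x y, adj G x y ->
    adj G x (rot G x y) /\ (forall z, adj G x z -> fconnect (rot G x) y z).

Definition connected_graph : Prop := forall x y, connect (adj G) x y.

Definition biconnected : Prop :=
  [/\ 2 < #|V|, connected_graph &
    forall c x y, x != c -> y != c ->
      connect [rel a b | [&& adj G a b, a != c & b != c]] x y].

Definition edges : {set {set V}} :=
  [set [set d.1; d.2] | d : V * V & adj G d.1 d.2].

(* A dart (x, y) is the edge xy traversed from x to y; iterating [face_next]
   walks around the face lying to one fixed side of the dart, so the faces
   are the orbits of [face_next] on darts. *)
Definition face_next (d : V * V) : V * V := (d.2, rot G d.2 d.1).

Definition face_of (d : V * V) : {set V * V} :=
  [set d' | fconnect face_next d d'].

Definition faces : {set {set V * V}} :=
  [set face_of d | d : V * V & adj G d.1 d.2].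

Definition face_vertices (F : {set V * V}) : {set V} := [set d.1 | d in F].

(* The surface carrying a connected embedded graph is the sphere exactly when
   Euler's formula holds, here V + F = E + 2. *)
Definition plane_graph : Prop :=
  [/\ simple_graph, rotation_system, connected_graph &
      #|V| + #|faces| = #|edges| + 2].

(* The boundary walk of F is closed by construction; it is a cycle of length k
   when it has k darts, issued from pairwise distinct vertices. *)
Definition bounded_by_cycle (k : nat) (F : {set V * V}) : Prop :=
  #|F| = k /\ {in F &, injective (@fst V V)}.

Definition closed_angulation (k : nat) : Prop :=
  [/\ plane_graph, biconnected &
      forall F, F \in faces -> bounded_by_cycle k F].

Definition face_hypergraph : {set {set V}} :=
  [set face_vertices F | F in faces].

End Embedding.

Definition planar_hypergraph (k : nat) (V : finType) (H : {set {set V}}) : Prop :=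
  exists2 G : embedding V, closed_angulation G k & H = face_hypergraph G.

Definition hypergraph_iso (V W : finType) (H : {set {set V}})
    (K : {set {set W}}) : Prop :=
  exists2 f : V -> W, bijective f &
    K = [set [set f v | v in (e : {set V})] | e in H].

Definition admissible (k n : nat) : Prop := k <= n /\ k - 2 %| 2 * (n - 2).

Section Theta.
Variables (t : nat) (p : 'I_t -> nat).

(* [inl false] and [inl true] are the branch vertices, and
   [Tagged _ a : {i & 'I_(p i)}] is the internal vertex number a of path i. *)
Definition theta_vertex : finType := (bool + {i : 'I_t & 'I_(p i)})%type.

(* Path i is theta_at i 0 = inl false, theta_at i 1, ..., theta_at i (p i),
   theta_at i (p i).+1 = inl true. *)
Definition theta_at (i : 'I_t) (j : nat) : theta_vertex :=
  if j is a.+1 then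
    if (insub a : option 'I_(p i)) is Some b then
      inr (Tagged (fun i => 'I_(p i)) b)
    else inl true
  else inl false.

Definition theta_adj : rel theta_vertex := fun x y =>
  [exists i : 'I_t, exists j : 'I_(p i).+1,
    ((x == theta_at i j) && (y == theta_at i j.+1))
    || ((y == theta_at i j) && (x == theta_at i j.+1))].

(* The paths leave [inl false] in the cyclic order 0, 1, ..., t - 1, hence
   reach [inl true] in the opposite one.  An internal vertex has exactly two
   neighbours, which are exchanged. *)
Definition theta_rot (x y : theta_vertex) : theta_vertex :=
  match x, y with
  | inl false, inr u => theta_at (ordS (tag u)) 1
  | inl true, inr u => let i := ord_pred (tag u) in theta_at i (p i)
  | inr u, _ =>
      let i := tag u in let a : nat := tagged u in
      if y == theta_at i a then theta_at i a.+2 else theta_at i a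
  | inl _, inl _ => y
  end.

Definition theta : embedding theta_vertex := Embedding theta_adj theta_rot.

Definition balanced (k : nat) : Prop :=
  [/\ 3 <= t, forall i, 1 <= p i & forall i, p i + p (ordS i) = k - 2].

End Theta.

Local Open Scope ring_scope.

Definition hypergraph_form (R : realType) (V : finType) (k : nat)
    (H : {set {set V}}) (x : V -> R) : R :=
  k%:R * \sum_(e in H) \prod_(v in e) x v.

Definition unit_weights (R : realType) (V : finType) (k : nat) : set (V -> R) :=
  [set x | (forall v, 0 <= x v) /\ \sum_v x v ^+ k = 1]%classic.

(* The supremum is a maximum, see [spectral_radius_max]. *)
Definition spectral_radius (R : realType) (V : finType) (k : nat)
    (H : {set {set V}}) : R :=
  sup (hypergraph_form k H @` unit_weights k)%classic.

Section Attained.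
Local Open Scope classical_set_scope.
Variables (R : realType) (V : finType) (k : nat) (H : {set {set V}}).
Hypotheses (k_gt0 : (0 < k)%N) (V_gt0 : (0 < #|V|)%N).

Let T : topologicalType := prod_topology (fun _ : V => R : topologicalType).

Let coord_continuous (v : V) : continuous (fun x : T => x v).
Proof. exact: (@proj_continuous V (fun _ => R : topologicalType) v). Qed.

Let form_continuous : continuous (hypergraph_form k H : T -> R).
Proof.
have prodc (e : {set V}) : continuous (fun x : T => \prod_(v in e) x v).
  apply: (@continuous_big R V *%R 1 (mem e) (@mul_continuous R) T) => v _.
  exact: coord_continuous.
have sumc : continuous (fun x : T => \sum_(e in H) \prod_(v in e) x v).
  apply: (@continuous_big R {set V} +%R 0 (mem H) (@add_continuous R) T) => e _.
  exact: prodc.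
move=> x.
apply: (@continuous_comp T R R (fun x => \sum_(e in H) \prod_(v in e) x v)
  (fun r => k%:R * r)); first exact: sumc.
exact: mulrl_continuous.
Qed.

Let weights_compact : compact (unit_weights k : set T).
Proof.
have closed_sum : closed [set x : T | \sum_v x v ^+ k = 1].
  apply: (@closed_comp _ _ (fun x : T => \sum_v x v ^+ k) [set 1]).
    move=> x _.
    apply: (@continuous_big R V +%R 0 predT (@add_continuous R) T) => v _ y.
    apply: (@continuous_comp T R R (fun x => x v) (fun r => r ^+ k)).
      exact: coord_continuous.
    exact: exprn_continuous.
  exact: closed_eq.
have box : compact [set x : T | forall v, `[0, 1]%classic (x v)].
  apply: (@tychonoff V (fun=> R : topologicalType) (fun=> `[0, 1]%classic)) => _.
  exact: segment_compact.
suff -> : (unit_weights k : set T) =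
    [set x : T | forall v, `[0, 1]%classic (x v)] `&`
    [set x : T | \sum_v x v ^+ k = 1] by exact: compact_closedI.
apply/seteqP; split=> x /= [x01 sx]; split=> // v; last first.
  by have := x01 v; rewrite in_itv /= => /andP[].
rewrite in_itv /= x01 /=.
rewrite -(@expr_le1 _ k) // -sx (bigD1 v) //= lerDl.
by apply: sumr_ge0 => w _; exact: exprn_ge0.
Qed.

Lemma spectral_radius_max :
  exists x : V -> R,
    [/\ unit_weights k x, hypergraph_form k H x = spectral_radius R k H &
        forall y : V -> R, unit_weights k y ->
          hypergraph_form k H y <= hypergraph_form k H x].
Proof.
have [v0 _] : exists v0, v0 \in V by apply/card_gt0P.
have w0 : (unit_weights k : set T) !=set0.
  exists (fun v => (v == v0)%:R); split=> [v|]; first exact: ler0n.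
  rewrite (bigD1 v0) //= eqxx expr1n big1 ?addr0 // => v /negbTE ->.
  by rewrite expr0n gtn_eqF.
have [x xW xmax] := compact_EVT_max w0 weights_compact
  (continuous_subspaceT form_continuous).
have {}xmax y : unit_weights k y ->
    hypergraph_form k H y <= hypergraph_form k H x.
  by move=> yW; apply: xmax; rewrite inE.
move: xW; rewrite inE => xW; exists x; split=> //.
apply/eqP; rewrite eq_le; apply/andP; split.
  apply: ub_le_sup; last by exists x.
  by exists (hypergraph_form k H x) => _ [y yW <-]; exact: xmax.
apply: ge_sup; first by exists (hypergraph_form k H x), x.
by move=> _ [y yW <-]; exact: xmax.
Qed.

End Attained.

(* Main.v *)
(* Let t = 2(n-2)/(k-2) be the number of faces. If every corner (v, F) carries a
   positive weight such that the weights at each vertex add up to at most 1 and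
   those of each face multiply to at least r^-k, then by the weighted AM-GM
   inequality the spectral radius is at most r. In a balanced theta graph,
   weight 1/t at the branch vertices and 1/2 elsewhere give r^k = 2^(k-2) t^2,
   and this value is attained.

   In an arbitrary closed k-angulation, let u and w be two vertices of largest
   degree and order the vertices by an st-numbering from u to w. Call a corner
   extremal if its vertex is a local minimum or maximum along the face, and
   lateral otherwise. By Euler's formula every face has exactly two extremal
   corners and every vertex other than u and w exactly two lateral ones. Let
   q(v) be the number of extremal corners at v, so that the q(v) add up to 2t,
   and let D = 2t - q(u) - q(w). If D = 0, all faces contain u and w and all
   other vertices have degree 2, which forces a balanced theta graph. If D > 0
   and t is large, weights close to 1/2 on lateral corners and close to 1/q(v)
   on extremal ones, suitably perturbed, make every face product exceed r^-k:
   a face with extremal corners at u and w gains because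
   q(u) + q(w) = 2t - D gives q(u) q(w) < t^2, with enough room left for a
   perturbation of order D, and the other faces gain a constant factor. *)
Require Import Defs.
From mathcomp Require Import all_boot all_order all_algebra.
From mathcomp Require Import all_classical all_reals all_analysis.
From mathcomp Require Import fintype finset.
From mathcomp Require Import zify ring lra.

Set Implicit Arguments.
Unset Strict Implicit.
Unset Printing Implicit Defensive.
Import Order.TTheory GRing.Theory Num.Theory.

(** * st-numberings *)

Section StOrder.
Variables (V : finType) (e : rel V).
Hypothesis e_sym : symmetric e.

(** The path is cut at its first vertex [a] in [S]; [c] is the vertex before it, and the stretch
    from [v] to [c] avoids [S]. *)
Lemma connect_exit (S : {pred V}) (r : rel V) (v y : V) :
  connect r v y -> v \notin S -> y \in S ->
  exists c a, [/\ connect [rel x z | [&& r x z, x \notin S & z \notin S]] v c,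
    c \notin S, a \in S & r c a].
Proof.
case/connectP=> p; elim: p v => [|z p IH] v /=.
  by move=> _ -> /negP.
case/andP=> rvz pz yE vS yS; have [zS|zS] := boolP (z \in S).
  by exists v, z; split=> //; exact: connect0.
have [c [a [vc cS aS rca]]] := IH z pz yE zS yS.
exists c, a; split=> //; apply: connect_trans vc; apply: connect1.
by rewrite /= rvz vS.
Qed.

Lemma index_insert (A p C : seq V) x : x \notin p ->
  index x (A ++ p ++ C) = index x (A ++ C) + (if x \in A then 0 else size p).
Proof.
move=> xp; rewrite !index_cat (negPf xp); case: ifP => _; first by rewrite addn0.
by rewrite -!addnA (addnC (size p)).
Qed.

Lemma index_insert_lt (A p C : seq V) x y : x \notin p -> y \notin p ->
  index x (A ++ C) < index y (A ++ C) ->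
  index x (A ++ p ++ C) < index y (A ++ p ++ C).
Proof.
move=> xp yp; rewrite !index_insert // !index_cat.
case: ifP => xA; case: ifP => yA; rewrite ?addn0 ?ltn_add2r //.
  by move/leq_trans; apply; exact: leq_addr.
by rewrite ltnNge (leq_trans _ (leq_addr _ _)) // ltnW // index_mem.
Qed.

(** A partial st-numbering. Absent elements have index [size l], so membership is demanded of the
    later neighbour [b], while an index below that of [v] already puts [a] in the list. *)
Definition st_list (s t : V) (l : seq V) := forall v, v \in l ->
  [\/ v = s, v = t | exists a b, [/\ e v a, e v b, b \in l,
                                    index a l < index v l & index v l < index b l]].

(* An ear from [a] to [b] is inserted just after the earlier of its two ends. *)
Lemma st_list_insert s t a b p l : uniq l -> head t l = s -> last s l = t ->
  st_list s t l -> a \in l -> b \in l -> a != b -> p != [::] -> uniq p ->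
  ~~ has (mem l) p -> path e a (rcons p b) ->
  exists l', [/\ uniq l', head t l' = s, last s l' = t, st_list s t l' &
                 size l < size l'].
Proof.
move=> ul hl tl stl; wlog: a b p / index a l < index b l.
  move=> W al bl ab p0 up pl pab.
  have [lt_ab|lt_ba|eq_ab] := ltngtP (index a l) (index b l).
  - exact: W lt_ab al bl ab p0 up pl pab.
  (* If [b] comes first, the ear is traversed backwards. *)
  - apply: (W b a (rev p)) lt_ba bl al _ _ _ _ _; rewrite ?rev_uniq ?has_rev //.
    + by rewrite eq_sym.
    + by case: (p) p0 => // x q _; rewrite rev_cons; case: (rev q).
    + have := rev_path e a (rcons p b).
      rewrite last_rcons belast_rcons rev_cons => ->.
      by rewrite (@eq_path _ _ e).
  - by rewrite -(nth_index a al) eq_ab nth_index ?eqxx in ab.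
move=> ltab al; case/splitPr: l / al ul hl tl stl ltab => A C ul hl tl stl ltab.
move=> bl ab p0 up pl pab.
have notp x : x \in A ++ a :: C -> x \notin p.
  by move=> xl; apply: contra pl => xp; apply/hasP; exists x.
have nota x : x \in p -> x \notin A ++ a :: C.
  by move=> xp; apply: contraNN pl => xl; apply/hasP; exists x.
have lE X : A ++ a :: X = rcons A a ++ X by rewrite cat_rcons.
have aA : a \notin A.
  by move: ul; rewrite cat_uniq /= => /and3P[_ /norP[]].
have bC : b \in C.
  move: bl ltab; rewrite mem_cat inE (negPf (_ : b != a)) 1?eq_sym //=.
  case/orP=> // bA; rewrite !index_cat bA (negPf aA) /= eqxx addn0.
  by rewrite ltnNge ltnW // index_mem.
have C0 : C != [::] by case: (C) bC.
exists (rcons A a ++ p ++ C); split.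
- move: ul; rewrite lE !cat_uniq up has_cat => /and3P[-> /= nC ->].
  rewrite (negPf nC) orbF /= andbT; apply/andP; split; apply/hasPn => x xp.
    by have := nota x xp; rewrite lE mem_cat negb_or => /andP[].
  apply: contraL xp => /nota; rewrite lE mem_cat negb_or => /andP[_]; exact.
- by rewrite -hl cat_rcons; case: (A).
- by rewrite -tl cat_rcons !last_cat /= last_cat; case: (C) C0.
- move=> v; rewrite !mem_cat orbCA => /orP[vp|]; last first.
    rewrite -mem_cat -lE => vl; case: (stl v vl) => [->|->|]; [exact: Or31|exact: Or32|].
    case=> x [y [evx evy yl xv vy]]; apply: Or33; exists x, y; split=> //.
    + by move: yl; rewrite lE !mem_cat => /orP[] ->; rewrite ?orbT.
    + apply: index_insert_lt; rewrite -?lE //; apply: notp => //.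
      by rewrite -index_mem (ltn_trans xv) // index_mem.
    + by apply: index_insert_lt; rewrite -?lE //; apply: notp.
  apply: Or33; case/splitPr: p / vp p0 up pl pab notp nota => p1 p2 _ up _.
  rewrite rcons_cat cat_path /= => /and3P[_ e1 e2] notp nota.
  have vp1 : v \notin p1.
    by move: up; rewrite cat_uniq /= => /and3P[_ /norP[]].
  have vA : v \notin rcons A a.
    have vin : v \in p1 ++ v :: p2 by rewrite mem_cat inE eqxx orbT.
    by have := nota v vin; rewrite lE mem_cat negb_or => /andP[].
  have iv : index v (rcons A a ++ (p1 ++ v :: p2) ++ C) = size (rcons A a) + size p1.
    rewrite index_cat (negPf vA) -catA /= index_cat (negPf vp1) /= eqxx.
    by rewrite addn0.
  (* The two neighbours of [v] along the ear. They default to its ends: [a], just before the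
     inserted block, and [b], which lies in [C] behind it. *)
  exists (last a p1), (head b p2); rewrite iv; split.
  + by rewrite e_sym.
  + by case: (p2) e2 => [|z q] /= /andP[].
  + case: (p2) => [|z q] /=; first by rewrite !mem_cat bC !orbT.
    by rewrite !mem_cat !inE eqxx !orbT.
  + case/lastP: (p1) nota => [|q z] nota /=.
      rewrite addn0 index_cat mem_rcons inE eqxx /= -cats1 index_cat (negPf aA) /=.
      by rewrite eqxx size_cat /= ltn_add2l.
    rewrite last_rcons.
    have zA : z \notin rcons A a.
      have zin : z \in rcons q z ++ v :: p2 by rewrite mem_cat mem_rcons inE eqxx.
      by have := nota z zin; rewrite lE mem_cat negb_or => /andP[].
    rewrite index_cat (negPf zA) ltn_add2l -catA index_cat mem_rcons inE eqxx /=.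
    by rewrite index_mem mem_rcons inE eqxx.
  + case: (p2) up nota => [|z q] up nota /=.
      have bp : b \notin p1 ++ [:: v].
        by apply: contraL bl => /nota.
      have bA : b \notin rcons A a.
        move: ul; rewrite lE cat_uniq => /and3P[_ /hasPn nC _].
        exact: nC.
      rewrite index_cat (negPf bA) ltn_add2l index_cat (negPf bp) size_cat /=.
      by rewrite addn1 addSn ltnS leq_addr.
    have zin : z \in p1 ++ [:: v, z & q] by rewrite mem_cat !inE eqxx !orbT.
    have zA : z \notin rcons A a.
      by have := nota z zin; rewrite lE mem_cat negb_or => /andP [].
    have zp1 : z \notin rcons p1 v.
      move: up; rewrite -cat_rcons cat_uniq => /and3P[_ /= /norP[]] //.
    rewrite index_cat (negPf zA) ltn_add2l index_cat zin -cat_rcons index_cat.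
    by rewrite (negPf zp1) size_rcons leq_addr.
- rewrite lE !size_cat ltn_add2l -[X in X < _]add0n ltn_add2r.
  by case: (p) p0.
Qed.

Hypothesis e_bic : forall c x y, x != c -> y != c ->
  connect [rel a b | [&& e a b, a != c & b != c]] x y.

(** An open ear decomposition: starting from [[:: s; t]], ears are inserted until no vertex is left
    out. *)
Lemma st_list_all s t : s != t ->
  exists l, [/\ uniq l, head t l = s, last s l = t, st_list s t l &
                forall v, v \in l].
Proof.
move=> st.
suff grow n : n <= #|V| -> exists l, [/\ uniq l, head t l = s, last s l = t,
    st_list s t l & n <= size l].
  have [l [ul hl tl stl sl]] := grow _ (leqnn _).
  exists l; split=> // v; apply: contraLR sl => vl; rewrite -ltnNge.
  have /card_uniqP <- := ul; rewrite -[#|l|]add0n -(cardC (mem l)) addnC ltn_add2l.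
  by apply/card_gt0P; exists v.
elim: n => [|n IH] nV.
  exists [:: s; t]; split=> //=; first by rewrite inE st.
  by move=> v; rewrite !inE => /orP[/eqP ->|/eqP ->]; [exact: Or31|exact: Or32].
have [l [ul hl tl stl]] := IH (ltnW nV).
rewrite leq_eqVlt => /predU1P[nl|nl]; last by exists l.
have [v vl] : exists v, v \notin l.
  apply/existsP; apply: contraLR nV; rewrite negb_exists => /forallP A.
  rewrite -ltnNge nl; have /card_uniqP <- := ul; rewrite ltnS subset_leq_card //.
  by apply/subsetP=> x _; move/negbNE: (A x).
have l0 : l != [::].
  by apply/eqP=> l0; rewrite l0 /= in tl; rewrite tl eqxx in st.
have sl : s \in l by case: (l) hl l0 => //= x q ->; rewrite inE eqxx.
have tl' : t \in l by case: (l) tl l0 => //= x q <- _; rewrite mem_last.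
have ne x : x \in l -> v != x by apply: contraTneq => <-.
(* From [v], a walk towards [s] that avoids [t] meets the list at some [a]. A second walk, towards
   [t] and avoiding [a], meets it at some [b], so the ear has distinct ends. *)
have [c [a [vc cl al /and3P[eca ct at']]]] :=
  connect_exit (S := mem l) (e_bic (ne _ tl') st) vl sl.
have at'' : t != a by rewrite eq_sym.
have [d [b [vd dl bl /and3P[edb dt ba]]]] :=
  connect_exit (S := mem l) (e_bic (ne _ al) at'') vl tl'.
pose e' := [rel x z | [&& e x z, x \notin l & z \notin l]].
have e'sym : connect_sym e'.
  by apply: sym_connect_sym => x y; rewrite /= e_sym (andbC (x \notin l)).
have sub1 x r : connect [rel x0 z | [&& [rel a0 b0 | [&& e a0 b0, a0 != r & b0 != r]] x0 z,
   x0 \notin mem l & z \notin mem l]] v x -> connect e' v x.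
  by apply: connect_sub => x0 y0 /= /and3P[/and3P[exy _ _] xl yl];
    apply: connect1; rewrite /= exy xl.
(* Up to [c] and [d] both walks stay outside the list, so they join [c] to [d] there; a simple path
   between these is the interior of the ear. *)
have: connect e' c d.
  by apply: connect_trans (sub1 _ _ vd); rewrite e'sym; exact: sub1 vc.
case/connectP=> q0 /shortenP[q pq uq _] dE.
have eq_path : path e a (rcons (c :: q) b).
  rewrite /= e_sym eca rcons_path -dE edb andbT.
  by apply: sub_path pq => x y /and3P[].
have disj : ~~ has (mem l) (c :: q).
  apply/hasPn => x; rewrite inE => /predU1P[-> //|].
  elim: (q) (c) pq => //= z r IHr y /andP[/and3P[_ _ zl] pz].
  by rewrite inE => /predU1P[->//|]; exact: IHr pz.
have ab : a != b by rewrite eq_sym.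
have [l' [ul' hl' tl'' stl' szl]] :=
  st_list_insert ul hl tl stl al bl ab (isT : c :: q != [::]) uq disj eq_path.
by exists l'; split=> //; rewrite nl.
Qed.

(* An st-numbering in the sense of Lempel, Even and Cederbaum. *)
Lemma st_numbering s t : s != t ->
  exists h : V -> nat, [/\ injective h, forall v, v != s -> h s < h v,
    forall v, v != t -> h v < h t &
    forall v, v != s -> v != t ->
      exists a b, [/\ e v a, e v b, h a < h v & h v < h b]].
Proof.
move=> st; have [l [ul hl tl stl al]] := st_list_all st.
have inj : injective (fun v => index v l).
  by move=> x y xy; rewrite -(nth_index s (al x)) xy nth_index.
have hs : index s l = 0.
  case: (l) hl al => [_ /(_ s)//|x q /= -> _]; by rewrite eqxx.
have ht : index t l = (size l).-1.
  case: (l) ul al tl => [_ /(_ s)//|x q uq _ /= <-].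
  by rewrite (last_nth s) -[LHS]/(index (nth s (x :: q) (size q)) (x :: q)) index_uniq.
exists (fun v => index v l); split=> //.
- move=> v vs; rewrite hs lt0n; apply: contra vs => /eqP v0.
  by apply/eqP; apply: inj; rewrite v0.
- move=> v vt; rewrite ltn_neqAle (inj_eq inj) vt /= ht.
  have := al v; rewrite -index_mem; case: (l) => // x q.
- move=> v vs vt; case: (stl v (al v)) => [E|E|].
  + by rewrite E eqxx in vs.
  + by rewrite E eqxx in vt.
  + by case=> a [b [? ? _ ? ?]]; exists a, b.
Qed.
End StOrder.

(** * Darts and faces *)

Lemma fconnect_exit (T : finType) (f : T -> T) (S : {set T}) (b : pred T) x y :
  {homo f : x / x \in S} -> x \in S -> b x -> ~~ b y -> fconnect f x y ->
  exists z, [/\ z \in S, b z & ~~ b (f z)].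
Proof.
move=> fS xS bx by_ /iter_findex; move: (findex f x y) => i; elim: i x xS bx => [|i IH] z zS bz.
  by move=> zy; rewrite -zy /= bz in by_.
rewrite iterSr => E; have [bfz|bfz] := boolP (b (f z)); last by exists z.
exact: IH (fS _ zS) bfz E.
Qed.

(** Around a cycle on which [b] takes both values, it switches once from true to false and once
    back, at two different places. *)
Lemma cyclic_changes_ge2 (T : finType) (f : T -> T) (S : {set T}) (b : pred T) x y :
  {homo f : x / x \in S} -> {in S &, forall x y, fconnect f x y} ->
  x \in S -> y \in S -> b x -> ~~ b y ->
  2 <= #|[set z in S | b z != b (f z)]|.
Proof.
move=> fS cS xS yS bx by_.
have [z [zS bz bfz]] := fconnect_exit fS xS bx by_ (cS x y xS yS).
have nb : ~~ predC b x by rewrite /= bx.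
have [w [wS bw bfw]] := fconnect_exit (b := predC b) fS yS by_ nb (cS y x yS xS).
rewrite /= in bw bfw; move/negbNE in bfw.
have zw : z != w by apply: contraNneq bw => <-.
have <- : #|[set z; w]| = 2 by rewrite cards2 zw.
apply/subset_leq_card/subsetP=> v; rewrite !inE => /orP[]/eqP->.
  by rewrite zS bz (negPf bfz).
by rewrite wS (negPf bw) bfw.
Qed.

Section Darts.
Variables (V : finType) (G : embedding V).

Definition darts : {set V * V} := [set d | adj G d.1 d.2].

Lemma in_darts x y : ((x, y) \in darts) = adj G x y.
Proof. by rewrite inE. Qed.

Hypotheses (G_simple : simple_graph G) (G_rot : rotation_system G).

Let adj_sym : symmetric (adj G). Proof. by case: G_simple. Qed.
Let adj_irr : irreflexive (adj G). Proof. by case: G_simple. Qed.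

Definition nbrs x : {set V} := [set y | adj G x y].

Lemma rot_nbrs x : {homo Defs.rot G x : y / y \in nbrs x}.
Proof. by move=> y; rewrite !inE => /G_rot[]. Qed.

Lemma rot_connect x : {in nbrs x &, forall y z, fconnect (Defs.rot G x) y z}.
Proof. by move=> y z; rewrite !inE => /G_rot[_]; exact. Qed.

(** Each neighbour is the image of one on its own orbit, so the rotation maps the finite set
    [nbrs x] onto itself. *)
Lemma rotation_inj x : {in nbrs x &, injective (Defs.rot G x)}.
Proof.
suff E : Defs.rot G x @: nbrs x = nbrs x.
  by apply/imset_injP; rewrite E.
apply/eqP; rewrite eqEsubset; apply/andP; split; apply/subsetP => y.
  by case/imsetP=> z /rot_nbrs zx ->.
move=> yx; have yx' := rot_nbrs yx.
have := rot_connect yx' yx => /iter_findex E; rewrite -{}E -iterSr iterS.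
by apply: imset_f; elim: (findex _ _ _) => //= i; exact: rot_nbrs.
Qed.

Lemma face_next_darts : {homo face_next G : d / d \in darts}.
Proof.
by move=> [x y]; rewrite !inE /= adj_sym => xy; have [] := G_rot xy.
Qed.

Lemma face_next_inj : {in darts &, injective (face_next G)}.
Proof.
move=> [x y] [z w]; rewrite !inE /= => xy zw [yw]; rewrite -{}yw in zw *.
by move/rotation_inj => ->; rewrite // inE adj_sym.
Qed.

Lemma face_of_sub d : d \in darts -> face_of G d \subset darts.
Proof.
move=> dD; apply/subsetP => d'; rewrite inE => /iter_findex <-.
by elim: (findex _ _ _) => //= i; exact: face_next_darts.
Qed.

Lemma mem_face_of d : d \in face_of G d.
Proof. by rewrite inE connect0. Qed.

(** Reachability by [face_next] is symmetric because this map is injective on darts; elsewhere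
    nothing is known of it. *)
Lemma face_of_eq d d' : d \in darts -> d' \in face_of G d ->
  face_of G d' = face_of G d.
Proof.
move=> dD d'd; have d'D := subsetP (face_of_sub dD) _ d'd.
rewrite inE in d'd; apply/setP=> x; rewrite !inE; apply/idP/idP.
  exact: connect_trans.
apply: connect_trans.
by rewrite (fconnect_sym_in face_next_darts face_next_inj).
Qed.

Lemma facesP F : reflect (exists2 d, d \in darts & F = face_of G d) (F \in faces G).
Proof.
apply: (iffP imsetP) => -[d dD ->]; exists d => //; move: dD; rewrite ?inE //.
Qed.

Lemma face_eq F d : F \in faces G -> d \in F -> F = face_of G d.
Proof. by case/facesP=> d' d'D -> dF; rewrite (face_of_eq d'D dF). Qed.

Lemma faces_partition : partition (faces G) darts.
Proof.
apply/and3P; split.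
- rewrite eqEsubset; apply/andP; split; apply/subsetP => d.
    by case/bigcupP=> F /facesP[d' d'D ->]; exact/subsetP/face_of_sub.
  move=> dD; apply/bigcupP; exists (face_of G d); last exact: mem_face_of.
  by apply/facesP; exists d.
- apply/trivIsetP => F F' FF FF'; rewrite -setI_eq0; apply: contraR.
  case/set0Pn=> d /setIP[dF dF'].
  by rewrite (face_eq FF dF) (face_eq FF' dF').
- by apply/negP => /facesP[d _ /setP/(_ d)]; rewrite mem_face_of inE.
Qed.

Lemma face_next_face F d : F \in faces G -> d \in F -> face_next G d \in F.
Proof.
move=> FF dF; rewrite (face_eq FF dF) inE; exact: fconnect1.
Qed.

Lemma face_sub F : F \in faces G -> F \subset darts.
Proof. by case/facesP=> d dD ->; exact: face_of_sub. Qed.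

Lemma face_next_imset F : F \in faces G -> face_next G @: F = F.
Proof.
move=> FF; apply/eqP; rewrite eqEcard; apply/andP; split.
  by apply/subsetP=> _ /imsetP[d dF ->]; exact: face_next_face.
rewrite card_in_imset // => d d' dF d'F; apply: face_next_inj;
  exact: subsetP (face_sub FF) _ _.
Qed.

Lemma face_vertices_snd F : F \in faces G -> face_vertices F = [set d.2 | d in F].
Proof.
by move=> FF; rewrite /face_vertices -{1}(face_next_imset FF) -imset_comp.
Qed.

Lemma card_darts_edges : #|darts| = 2 * #|edges G|.
Proof.
have -> : edges G = [set [set d.1; d.2] | d in darts].
  by apply/setP=> E; apply/imsetP/imsetP=> -[d dD ->]; exists d; move: dD; rewrite ?inE.
rewrite -sum1_card (partition_big_imset (fun d : V * V => [set d.1; d.2])) /=.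
rewrite -sum1_card big_distrr /=; apply: eq_bigr => _ /imsetP[[a b] abD ->] /=.
rewrite muln1 sum1dep_card -[RHS](_ : #|[set (a, b); (b, a)]| = 2); last first.
  rewrite cards2 xpair_eqE; case: eqP abD => // ->; by rewrite in_darts adj_irr.
apply: eq_card => -[x y]; rewrite [LHS]inE [RHS]inE !inE !xpair_eqE /=.
apply/andP/idP=> [[xy /eqP E]|].
  have : x \in [set a; b] by rewrite -E !inE eqxx.
  have : y \in [set a; b] by rewrite -E !inE eqxx orbT.
  have : x != y by apply: contraTneq xy => ->; rewrite adj_irr.
  rewrite !inE => xy' /orP[]/eqP yE /orP[]/eqP xE; move: xy'; rewrite xE yE ?eqxx ?orbT //.
by rewrite in_darts in abD; case/orP=> /andP[/eqP-> /eqP->];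
  rewrite ?abD // adj_sym abD setUC.
Qed.
End Darts.

(** * Lateral and extremal corners *)

Section Angulation.
Variables (V : finType) (G : embedding V) (k : nat).
Hypothesis G_ang : closed_angulation G k.

Lemma angulation_simple : simple_graph G. Proof. by case: G_ang => -[]. Qed.
Lemma angulation_rot : rotation_system G. Proof. by case: G_ang => -[]. Qed.
Let GS := angulation_simple.
Let GR := angulation_rot.
Let adj_sym : symmetric (adj G). Proof. by case: GS. Qed.
Let adj_irr : irreflexive (adj G). Proof. by case: GS. Qed.

Lemma card_face F : F \in faces G -> #|F| = k.
Proof. by case: G_ang => _ _ /(_ F) H /H[]. Qed.

Lemma face_fst_inj F : F \in faces G -> {in F &, injective (@fst V V)}.
Proof. by case: G_ang => _ _ /(_ F) H /H[]. Qed.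

Lemma face_snd_inj F : F \in faces G -> {in F &, injective (@snd V V)}.
Proof.
move=> FF d d' dF d'F E; have FD := subsetP (face_sub GS GR FF).
apply: (face_next_inj GS GR) (FD _ dF) (FD _ d'F) _.
by apply: (face_fst_inj FF) => //; exact: face_next_face.
Qed.

Lemma card_darts_faces : #|darts G| = k * #|faces G|.
Proof.
rewrite mulnC; apply: card_uniform_partition (faces_partition GS GR) => F.
exact: card_face.
Qed.

Lemma angulation_euler : 2 * #|V| + 2 * #|faces G| = k * #|faces G| + 4.
Proof.
case: G_ang => -[_ _ _ E] _ _; rewrite -card_darts_faces card_darts_edges //; lia.
Qed.

Lemma angulation_st_numbering s t : s != t ->
  exists h : V -> nat, [/\ injective h, forall v, v != s -> h s < h v,
    forall v, v != t -> h v < h t &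
    forall v, v != s -> v != t ->
      exists a b, [/\ adj G v a, adj G v b, h a < h v & h v < h b]].
Proof.
move=> st; apply: st_numbering => //.
by case: G_ang => _ [].
Qed.

Section Lateral.
Variables (h : V -> nat) (s t : V).
Hypotheses (st : s != t) (h_inj : injective h).
Hypotheses (h_min : forall v, v != s -> h s < h v)
           (h_max : forall v, v != t -> h v < h t).
Hypothesis h_mid : forall v, v != s -> v != t ->
  exists a b, [/\ adj G v a, adj G v b, h a < h v & h v < h b].

(* A dart stands for the corner of its face at its end vertex; the corner is
   lateral when the boundary walk is monotone in [h] there. *)
Definition lateral (e : V * V) :=
  (h e.1 < h e.2) == (h (face_next G e).1 < h (face_next G e).2).

Let h_neq x y : x != y -> (h x < h y) = ~~ (h y < h x).
Proof. by move=> xy; rewrite -leqNgt ltn_neqAle (inj_eq h_inj) xy. Qed.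

Let adj_neq x y : adj G x y -> x != y.
Proof. by apply: contraTneq => ->; rewrite adj_irr. Qed.

(** In the cyclic order around [v], the neighbours switch at least twice between lower and higher.
    The dart [(z, v)] carries the corner between z and its successor, which is lateral exactly when
    a switch occurs there. *)
Lemma lateral_ge2 v : v != s -> v != t ->
  2 <= #|[set e in darts G | (e.2 == v) && lateral e]|.
Proof.
move=> vs vt; have [a [b [va vb ha hb]]] := h_mid vs vt.
have := @cyclic_changes_ge2 _ (Defs.rot G v) (nbrs G v) (fun z => h z < h v) a b
  (rot_nbrs GR (x:=v)) (rot_connect GR (x:=v)).
rewrite !inE -leqNgt => /(_ va vb ha (ltnW hb)) /leq_trans; apply.
rewrite -(card_imset _ (_ : injective (fun z => (z, v)))); last by move=> x y [].
apply/subset_leq_card/subsetP => _ /imsetP[z + ->]; rewrite !inE /lateral /= eqxx /=.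
case/andP=> vz; rewrite adj_sym vz /=; have [vz' _] := GR vz.
by rewrite (h_neq (adj_neq vz')); case: (_ < _); case: (_ < _).
Qed.

(** All neighbours of [s] lie above it and all neighbours of [t] below it, so no boundary walk is
    monotone there. *)
Lemma lateral_extremity v e : v \in [:: s; t] -> e \in darts G -> e.2 = v ->
  ~~ lateral e.
Proof.
move=> vst; case: e => x y; rewrite in_darts /= => xy yv; rewrite -{}yv in vst.
have yx : adj G y x by rewrite adj_sym.
have [yz _] := GR yx; rewrite /lateral /=.
have := adj_neq yz; have := adj_neq yx; rewrite eq_sym => xy'; rewrite eq_sym => zy.
move: vst; rewrite !inE => /orP[]/eqP yE; rewrite yE in xy' zy *.
  by rewrite (h_min zy) ltnNge (ltnW (h_min xy')).
by rewrite (h_max xy') ltnNge (ltnW (h_max zy)).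
Qed.

(** The boundary walk rises when it leaves its minimum and falls when it leaves its maximum, so its
    direction changes at least twice. *)
Lemma extremal_ge2 F : F \in faces G -> 2 <= #|[set e in F | ~~ lateral e]|.
Proof.
move=> FF; have FD := subsetP (face_sub GS GR FF).
have FX e : e \in F -> (face_next G e) \in F by exact: face_next_face.
have [d0 d0F] : exists d, d \in F by case/facesP: FF => d _ ->; exists d; exact: mem_face_of.
have ud e : e \in F -> h e.1 != h e.2.
  by move=> /FD; rewrite inE (inj_eq h_inj); exact: adj_neq.
case: (arg_minnP (fun e : V * V => h e.1) d0F) => x xF xmin.
case: (arg_maxnP (fun e : V * V => h e.1) d0F) => y yF ymax.
have cF : {in F &, forall x y, fconnect (face_next G) x y}.
  by move=> a b aF bF; rewrite (face_eq GS GR FF aF) inE in bF.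
have := cyclic_changes_ge2 (b := fun e => h e.1 < h e.2) FX cF xF yF.
move=> H; apply: leq_trans (H _ _) _.
- by rewrite ltn_neqAle ud //=; exact: xmin (FX _ xF).
- by rewrite -leqNgt; exact: ymax (FX _ yF).
- by apply: subset_leq_card; apply/subsetP => e; rewrite !inE.
Qed.

(* There are at least two lateral corners at every vertex but [s] and [t], and
   at least two extremal ones on every face; by Euler's formula these bounds
   already add up to the number of all corners. *)
Lemma lateral_extremal_count :
  (forall v, v != s -> v != t ->
     #|[set e in darts G | (e.2 == v) && lateral e]| = 2) /\
  (forall F, F \in faces G -> #|[set e in F | ~~ lateral e]| = 2).
Proof.
pose L v := #|[set e in darts G | (e.2 == v) && lateral e]|.
pose X (F : {set V * V}) := #|[set e in F | ~~ lateral e]|.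
pose Lm v := if (v == s) || (v == t) then 0 else 2.
have LmL v : Lm v <= L v.
  by rewrite /Lm; case: ifP => // /norP[vs vt]; exact: lateral_ge2.
have sumLm : \sum_v Lm v + 4 = 2 * #|V|.
  rewrite (bigD1 s) //= (bigD1 t) 1?eq_sym //= {1 2}/Lm !eqxx orbT !add0n.
  rewrite (eq_bigr (fun=> 2)); last by move=> v /andP[/negPf vs /negPf vt]; rewrite /Lm vs vt.
  rewrite sum_nat_const (eq_card (B := ~: [set s; t])); last first.
    by move=> v; rewrite !inE negb_or.
  have := cardsC [set s; t]; rewrite cards2 st /=; lia.
have total : \sum_v L v + \sum_(F in faces G) X F = #|darts G|.
  rewrite -sum1_card (bigID lateral) /=; congr (_ + _).
    rewrite (partition_big (fun e : V * V => e.2) predT) //=; apply: eq_bigr => v _.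
    rewrite /L -sum1_card; apply: eq_bigl => e; rewrite !inE -andbA; congr (_ && _).
    by rewrite andbC.
  have /and3P[/eqP cov triv _] := faces_partition GS GR; rewrite -cov.
  rewrite big_trivIset_cond //=; apply: eq_bigr => F _.
  by rewrite /X -sum1_card; apply: eq_bigl => e; rewrite !inE.
have LE : \sum_v L v = \sum_v (L v - Lm v) + \sum_v Lm v.
  by rewrite -big_split /=; apply: eq_bigr => v _; rewrite subnK.
have XE : \sum_(F in faces G) X F = \sum_(F in faces G) (X F - 2) + 2 * #|faces G|.
  rewrite mulnC -sum_nat_const -big_split /=; apply: eq_bigr => F FF.
  by rewrite subnK //; exact: extremal_ge2.
(* The lower bounds add up to 2(n - 2) + 2t, which by Euler's formula is the number kt of all
   corners; every excess is therefore 0. *)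
have := angulation_euler; have := card_darts_faces.
move=> cD eu; have [z1 z2] : \sum_v (L v - Lm v) = 0 /\ \sum_(F in faces G) (X F - 2) = 0.
  by move: total LE XE; lia.
split=> [v vs vt|F FF].
  have /eqP := z1; rewrite sum_nat_eq0 => /forallP/(_ v)/=.
  have := lateral_ge2 vs vt; rewrite -/(L v) /Lm (negPf vs) (negPf vt) /=; lia.
have /eqP := z2; rewrite sum_nat_eq0 => /forallP/(_ F); rewrite FF /=.
have := extremal_ge2 FF; rewrite -/(X F); lia.
Qed.
End Lateral.
End Angulation.

(** * Balanced theta graphs *)

Lemma fconnect_period (T : finType) (f : T -> T) (x y : T) (k : nat) :
  0 < k -> iter k f x = x -> fconnect f x y -> exists2 m, m < k & y = iter m f x.
Proof.
move=> k0 fk /iter_findex <-; move: (findex f x y) => n.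
exists (n %% k); first exact: ltn_pmod.
rewrite {1}(divn_eq n k) addnC iterD; congr iter.
by elim: (n %/ k) => //= q IH; rewrite mulSn iterD IH.
Qed.

Lemma iter_ordS n (i : 'I_n) m : iter m (@ordS n) i = (i + m) %% n :> nat.
Proof.
elim: m => [|m IH] /=; first by rewrite addn0 modn_small.
by rewrite IH -addn1 modnDml addn1 addnS.
Qed.

Lemma fconnect_ordS n (i j : 'I_n) : fconnect (@ordS n) i j.
Proof.
have -> : j = iter (n - i + j) (@ordS n) i; last exact: fconnect_iter.
apply: val_inj; rewrite /= iter_ordS addnA subnKC 1?ltnW //.
by rewrite modnDl modn_small.
Qed.

Lemma fconnect_ord_pred n (i j : 'I_n) : fconnect (@ord_pred n) i j.
Proof.
have /iter_findex <- := fconnect_ordS j i; elim: (findex _ _ _) => //= m IH.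
by apply: connect_trans IH; apply: connect1; rewrite /= ordSK.
Qed.

Lemma ordS_neq n (i : 'I_n) : 2 <= n -> ordS i != i.
Proof.
move=> n2; apply/eqP => /(congr1 val) /=; case: (ltngtP i.+1 n) => [lt|gt|E].
- by rewrite modn_small //; lia.
- by have := ltn_ord i; lia.
- by rewrite E modnn; lia.
Qed.

Lemma ordS2_neq n (i : 'I_n) : 3 <= n -> ordS (ordS i) != i.
Proof.
move=> n2; apply/eqP => /(congr1 (@nat_of_ord n)) E.
have {}E : (i + 2) %% n = i by rewrite -iter_ordS.
 have := ltn_ord i; have := divn_eq (i + 2) n; rewrite E.
by case: (_ %/ _) => [|[|q]]; lia.
Qed.

Section Theta.
Variables (t k : nat) (p : 'I_t -> nat).
Hypothesis p_bal : balanced p k.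

Let t3 : 3 <= t. Proof. by case: p_bal. Qed.
Let p_gt0 i : 0 < p i. Proof. by case: p_bal. Qed.
Let k_gt2 : 2 < k.
Proof.
pose i : 'I_t := Ordinal (leq_trans (isT : 0 < 3) t3).
by case: p_bal => _ _ /(_ i); have := p_gt0 i; lia.
Qed.
Let pE i : p i + p (ord_pred i) + 2 = k.
Proof. by case: p_bal => _ _ /(_ (ord_pred i)); rewrite ord_predK; lia. Qed.

Notation at_ := (@theta_at t p).

Lemma theta_at_in i j (lt_j : j < p i) :
  at_ i j.+1 = inr (Tagged (fun i => 'I_(p i)) (Ordinal lt_j)).
Proof. by rewrite /theta_at insubT. Qed.

Lemma theta_at_end i : at_ i (p i).+1 = inl true.
Proof. by rewrite /theta_at insubN // -leqNgt. Qed.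

Lemma theta_atP x : exists i j, j <= (p i).+1 /\ x = at_ i j.
Proof.
pose i0 : 'I_t := Ordinal (leq_trans (isT : 0 < 3) t3).
case: x => [[]|[i [a lt_a]]].
- by exists i0, (p i0).+1; rewrite theta_at_end.
- by exists i0, 0.
- by exists i, a.+1; rewrite (theta_at_in lt_a) ltnS (ltnW lt_a).
Qed.

(** The position [j'] is unrestricted, as [theta_at] sends everything beyond the end of a path to
    [inl true], which is not internal. *)
Lemma theta_at_inj i i' j j' : 0 < j <= p i -> at_ i j = at_ i' j' -> i = i' /\ j = j'.
Proof.
case: j => // j /andP[_ lt_j]; rewrite (theta_at_in lt_j).
case: j' => [//|j']; have [lt'|ge'] := ltnP j' (p i'); last first.
  by rewrite /theta_at insubN // -leqNgt.
rewrite (theta_at_in lt').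
have inr_inj (a b : {i : 'I_t & 'I_(p i)}) :
  inr a = inr b :> theta_vertex p -> a = b by case.
move/inr_inj => E; have Ei : i = i' by exact: (congr1 (@tag _ _) E).
by subst i'; move/eqP: E; rewrite eq_Tagged /= => /eqP/(congr1 val)/= ->.
Qed.

Lemma theta_at_inj1 i j j' : j <= (p i).+1 -> j' <= (p i).+1 -> at_ i j = at_ i j' -> j = j'.
Proof.
case: j j' => [|j] [|j'] // le_j le_j'.
- have [lt_j|ge_j] := ltnP j' (p i); first by rewrite (theta_at_in lt_j).
  by rewrite (_ : j' = p i) ?theta_at_end //; lia.
- have [lt_j|ge_j] := ltnP j (p i); first by rewrite (theta_at_in lt_j).
  by rewrite (_ : j = p i) ?theta_at_end //; lia.
- have [lt_j|ge_j] := ltnP j (p i).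
    by move/(theta_at_inj (_ : 0 < j.+1 <= p i)) => /(_ lt_j)[].
  have [lt_j'|ge_j'] := ltnP j' (p i); last by lia.
  by move/esym/(theta_at_inj (_ : 0 < j'.+1 <= p i)) => /(_ lt_j')[_ ->].
Qed.

Lemma theta_rot_false i : theta_rot (inl false) (at_ i 1) = at_ (ordS i) 1.
Proof. by rewrite (theta_at_in (p_gt0 i)). Qed.

Lemma theta_rot_true i :
  theta_rot (inl true) (at_ i (p i)) = at_ (ord_pred i) (p (ord_pred i)).
Proof.
have := p_gt0 i; case E: (p i) => [//|a] _.
have lt_a : a < p i by rewrite E.
by rewrite (theta_at_in lt_a).
Qed.

Lemma theta_rot_forward i j : j < p i ->
  theta_rot (at_ i j.+1) (at_ i j) = at_ i j.+2.
Proof. by move=> lt_j; rewrite (theta_at_in lt_j) /= eqxx. Qed.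

Lemma theta_rot_backward i j : j < p i ->
  theta_rot (at_ i j.+1) (at_ i j.+2) = at_ i j.
Proof.
by move=> lt_j; rewrite (theta_at_in lt_j) [LHS]/=; case: eqP.
Qed.

Lemma theta_adjP x y : reflect (exists i j, j <= p i /\
    ((x = at_ i j /\ y = at_ i j.+1) \/ (y = at_ i j /\ x = at_ i j.+1)))
  (theta_adj x y).
Proof.
apply: (iffP existsP) => [[i /existsP[j H]]|[i [j [le_j H]]]].
  exists i, (val j); split; first by exact: (ltn_ord j).
  by case/orP: H => /andP[/eqP-> /eqP->]; [left|right].
exists i; apply/existsP; exists (Ordinal (le_j : j < (p i).+1)) => /=.
by case: H => [[-> ->]|[-> ->]]; rewrite !eqxx ?orbT.
Qed.

Lemma theta_adj_at i j : j <= p i -> theta_adj (at_ i j) (at_ i j.+1).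
Proof. by move=> le_j; apply/theta_adjP; exists i, j; split=> //; left. Qed.

Lemma theta_adj_sym : symmetric (@theta_adj t p).
Proof.
by move=> x y; apply/theta_adjP/theta_adjP => -[i [j [le_j []]]] [-> ->];
  exists i, j; split=> //; [right|left|right|left].
Qed.

Lemma theta_simple : simple_graph (theta p).
Proof.
split; first exact: theta_adj_sym.
move=> x; apply/negbTE/negP => xx; have /theta_adjP[i [j [le_j xE]]] : theta_adj x x := xx.
suff : j = j.+1 by lia.
by apply: (@theta_at_inj1 i); rewrite ?(leqW le_j) //; case: xE => -[<- <-].
Qed.

(* The vertices in order along the face between paths [ord_pred i] and [i],
   out along the latter and back along the former. *)
Definition theta_ring i m := if m <= p i then at_ i m else at_ (ord_pred i) (k - m).
Notation ring := theta_ring.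

Let ring0 i : ring i 0 = inl false. Proof. by []. Qed.
Let ring_top i : ring i (p i).+1 = inl true.
Proof. by rewrite /theta_ring ltnn -(theta_at_end (ord_pred i)); congr at_; have := pE i; lia. Qed.
Let ring_k i : ring i k = inl false.
Proof. by rewrite /theta_ring subnn; case: leqP => //; have := pE i; lia. Qed.
Let ring_at i j : j <= (p i).+1 -> ring i j = at_ i j.
Proof.
rewrite leq_eqVlt => /predU1P[->|]; first by rewrite ring_top theta_at_end.
by rewrite ltnS /ring => ->.
Qed.
Let ring_back i j : j <= (p i).+1 -> ring (ordS i) (k - j) = at_ i j.
Proof.
rewrite leq_eqVlt => /predU1P[->|lt_j].
  rewrite theta_at_end -(ring_top (ordS i)); congr ring.
  by have := pE (ordS i); rewrite ordSK; lia.
have := pE (ordS i); rewrite ordSK => E; rewrite /theta_ring ordSK.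
by case: leqP => [|_]; [lia|congr at_; lia].
Qed.

(** The walk goes out along path [i], turns at [inl true] and comes back along path [ord_pred i];
    the cases are these three stages. *)
Let ring_rot i m : m.+2 <= k ->
  theta_rot (ring i m.+1) (ring i m) = ring i m.+2.
Proof.
move=> le_m; have E := pE i; have [lt_m|ge_m] := ltnP m (p i).
  by rewrite !ring_at; [exact: theta_rot_forward|lia|lia|lia].
have [eq_m|gt_m] := eqVneq m (p i).
  rewrite eq_m ring_top ring_at // theta_rot_true.
  have := @ring_back (ord_pred i) (p (ord_pred i)); rewrite ord_predK => <- //.
  by congr ring; lia.
have rb j : j <= (p (ord_pred i)).+1 -> ring i (k - j) = at_ (ord_pred i) j.
  by move=> le_j; rewrite -ring_back ?ord_predK.
have -> : m = k - (k - m.+2).+2 by lia.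
have -> : (k - (k - m.+2).+2).+1 = k - (k - m.+2).+1 by lia.
have -> : (k - (k - m.+2).+1).+1 = k - (k - m.+2) by lia.
rewrite !rb; [apply: theta_rot_backward|..]; lia.
Qed.

Let ring_rot_last i : theta_rot (ring i k) (ring i k.-1) = ring i 1.
Proof.
have E := pE i; have Ep := p_gt0 (ord_pred i); rewrite ring_k.
have := @ring_back (ord_pred i) 1; rewrite ord_predK subn1 => -> //.
by rewrite theta_rot_false ord_predK ring_at.
Qed.

Let start i := (ring i 0, ring i 1).

Let iter_face i m : m < k ->
  iter m (face_next (theta p)) (start i) = (ring i m, ring i m.+1).
Proof.
elim: m => [//|m IH] lt_m; rewrite iterS IH ?(ltnW lt_m) //.
by rewrite /face_next /= ring_rot.
Qed.

Let iter_face_k i : iter k (face_next (theta p)) (start i) = start i.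
Proof.
have -> : k = k.-1.+1 by lia.
rewrite iterS iter_face; last by lia.
have -> : k.-1.+1 = k by lia.
by rewrite /face_next /= ring_rot_last /start ring_k.
Qed.

(** The forward darts of path [i] lie on the face of [i], the backward ones on the face of
    [ordS i]. *)
Lemma theta_dart_face x y : theta_adj x y ->
  exists i m, m < k /\ (x, y) = iter m (face_next (theta p)) (start i).
Proof.
case/theta_adjP=> i [j [le_j [[-> ->]|[-> ->]]]].
  exists i, j; have := pE i => E; rewrite iter_face ?ring_at //; try lia.
  by split=> //; lia.
have := pE (ordS i); rewrite ordSK => E; exists (ordS i), (k - j.+1).
split; first by lia.
rewrite iter_face; last by lia.
have -> : (k - j.+1).+1 = k - j by lia.
by rewrite !ring_back //; lia.
Qed.

Let ring_adj i m : m < k -> theta_adj (ring i m) (ring i m.+1).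
Proof.
move=> lt_m; have E := pE i; have [le_m|gt_m] := leqP m (p i).
  by rewrite !ring_at; [apply: theta_adj_at|lia|lia].
have rb j : j <= (p (ord_pred i)).+1 -> ring i (k - j) = at_ (ord_pred i) j.
  by move=> le_j; rewrite -ring_back ?ord_predK.
have -> : m = k - (k - m.+1).+1 by lia.
have -> : (k - (k - m.+1).+1).+1 = k - (k - m.+1) by lia.
by rewrite !rb 1?theta_adj_sym; [apply: theta_adj_at|..]; lia.
Qed.

Lemma theta_face_next_dart d : theta_adj d.1 d.2 ->
  theta_adj (face_next (theta p) d).1 (face_next (theta p) d).2.
Proof.
case: d => x y /theta_dart_face[i [m [lt_m ->]]]; rewrite -iterS.
have [lt_m'|] := ltnP m.+1 k; first by rewrite iter_face // ring_adj.
by move=> ge_m; have -> : m.+1 = k by [lia]; rewrite iter_face_k ring_adj; lia.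
Qed.

Lemma theta_nbr_false y : theta_adj (inl false) y -> exists i, y = at_ i 1.
Proof.
case/theta_adjP=> i [j [le_j [[E ->]|[-> E]]]]; exists i.
  by rewrite (@theta_at_inj1 i j 0) //; exact: leqW.
by have := @theta_at_inj1 i 0 j.+1 isT le_j E.
Qed.

Lemma theta_nbr_true y : theta_adj (inl true) y -> exists i, y = at_ i (p i).
Proof.
case/theta_adjP=> i [j [le_j]]; rewrite -(theta_at_end i) => -[[E ->]|[-> E]]; exists i.
  by have := theta_at_inj1 (leqnn _) (leqW le_j) E; lia.
by have [->] := theta_at_inj1 (leqnn (p i).+1) (le_j : j.+1 <= (p i).+1) E.
Qed.

Lemma theta_nbr_in i j y : j < p i -> theta_adj (at_ i j.+1) y ->
  y = at_ i j \/ y = at_ i j.+2.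
Proof.
move=> lt_j; have j_in : 0 < j.+1 <= p i by [].
case/theta_adjP=> i' [j' [le_j [[E ->]|[-> E]]]].
  by have [<- <-] := theta_at_inj j_in E; right.
by have [<- [<-]] := theta_at_inj j_in E; left.
Qed.

Lemma fconnect_homo (S T : finType) (f : S -> S) (g : T -> T) (h : S -> T) a b :
  (forall x, g (h x) = h (f x)) -> fconnect f a b -> fconnect g (h a) (h b).
Proof.
move=> gh /iter_findex <-; elim: (findex f a b) => //= n IH.
by apply: connect_trans IH _; apply: connect1; rewrite /= gh.
Qed.

(** The rotation follows [ordS] at [inl false] and [ord_pred] at [inl true], both single cycles; at
    an internal vertex it exchanges two neighbours. *)
Lemma theta_rotation : rotation_system (theta p).
Proof.
move=> x y xy; split.
  by apply: (theta_face_next_dart (d := (y, x))); rewrite /= theta_adj_sym.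
move: xy; rewrite /=; have [i [j [le_j ->]]] := theta_atP x.
case: j le_j => [_|j].
  move=> /theta_nbr_false[a ->] z /theta_nbr_false[b ->].
  exact: (fconnect_homo theta_rot_false (fconnect_ordS a b)).
rewrite ltnS leq_eqVlt => /predU1P[->|lt_j].
  rewrite theta_at_end => /theta_nbr_true[a ->] z /theta_nbr_true[b ->].
  exact: (fconnect_homo theta_rot_true (fconnect_ord_pred a b)).
move=> ny z nz; have [yE zE] := (theta_nbr_in lt_j ny, theta_nbr_in lt_j nz).
have ro := theta_rot_forward lt_j; have rb := theta_rot_backward lt_j.
case: yE => ->; case: zE => ->; rewrite ?connect0 //; apply: connect1; rewrite /= ?ro ?rb //.
Qed.

Lemma theta_segment_connect (r : rel (theta_vertex p)) c i a b :
  (forall x y, theta_adj x y -> x != c -> y != c -> r x y) -> a <= b <= (p i).+1 ->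
  (forall m, a <= m <= b -> at_ i m != c) -> connect r (at_ i a) (at_ i b).
Proof.
move=> adj_r; elim: b => [|b IH] /andP[le_a le_b] nc.
  by move: le_a; rewrite leqn0 => /eqP->.
move: le_a; rewrite leq_eqVlt => /predU1P[->//|]; rewrite ltnS => le_a.
apply: connect_trans (IH _ _) _; first by rewrite le_a ltnW.
  by move=> m /andP[h1 h2]; apply: nc; rewrite h1 leqW.
by apply: connect1; apply: adj_r; [exact: theta_adj_at|apply: nc; lia|apply: nc; lia].
Qed.

(** All remaining vertices are joined to one branch vertex: to [inl true] if [inl false] is deleted,
    and to [inl false] otherwise. *)
Lemma theta_biconnected : biconnected (theta p).
Proof.
have bic c x y : x != c -> y != c -> connect
    [rel a b | [&& adj (theta p) a b, a != c & b != c]] x y.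
  have [i0 [j0 [le_j0 ->]]] := theta_atP c; set c0 := at_ i0 j0.
  set r := [rel _ _ | _]; have r_sym : connect_sym r.
    by apply: sym_connect_sym => a b; rewrite /= theta_adj_sym (andbC (a != _)).
  suff [z zP] : exists z, forall x, x != c0 -> connect r x z.
    by move=> xc yc; apply: connect_trans (zP _ xc) _; rewrite r_sym; exact: zP.
  have adj_r a b : theta_adj a b -> a != c0 -> b != c0 -> r a b.
    by move=> ? ? ?; apply/and3P.
  have seg := theta_segment_connect adj_r.
  have up i j : j <= (p i).+1 -> (forall m, j <= m <= (p i).+1 -> at_ i m != c0) ->
      connect r (at_ i j) (inl true).
    by move=> le_j H; rewrite -(theta_at_end i); apply: seg; rewrite // le_j leqnn.
  have down i j : j <= (p i).+1 -> (forall m, m <= j -> at_ i m != c0) ->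
      connect r (at_ i j) (inl false).
    by move=> le_j H; rewrite r_sym; apply: (seg i 0).
  have [j0E|j0_gt0] := posnP j0.
    exists (inl true) => {}x; have [i [j [le_j ->]]] := theta_atP x => jc.
    apply: up => // m /andP[le_m le_mp]; apply: contra jc; rewrite /c0 j0E => /eqP m0.
    have {}m0 : m = 0 by exact: (@theta_at_inj1 i m 0 le_mp isT m0).
    by move: le_m; rewrite m0 leqn0 => /eqP->.
  exists (inl false) => {}x; have [i [j [le_j ->]]] := theta_atP x => jc.
  have [j0_le|j0_gt] := leqP j0 (p i0); last first.
    have c0E i' : c0 = at_ i' (p i').+1.
      by rewrite theta_at_end -(theta_at_end i0); congr at_; lia.
    apply: down => // m le_m; apply: contra jc; rewrite (c0E i) => /eqP mE.
    have {}mE := theta_at_inj1 (leq_trans le_m le_j) (leqnn _) mE.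
    by apply/eqP; congr at_; lia.
  have c_in : 0 < j0 <= p i0 by rewrite j0_gt0.
  have [/hasP[m]|/hasPn no] := boolP (has (fun m => at_ i m == c0) (iota 0 j.+1)); last first.
    by apply: down => // m le_m; apply: no; rewrite mem_iota add0n ltnS.
  rewrite mem_iota add0n ltnS => /= le_m /eqP/esym/(theta_at_inj c_in)[ii jm].
  rewrite -{}ii -{}jm in jc le_j le_m *; have jj : j != j0 by apply: contraNneq jc => ->.
  (* The deleted vertex separates the current one from [inl false] on its path, so the route goes up
     to [inl true] and returns along the next path. *)
  apply: (@connect_trans _ _ (inl true)).
    apply: up => // m' /andP[le_m' _]; apply/eqP => /esym/(theta_at_inj c_in)[_]; lia.
  rewrite -(theta_at_end (ordS i0)); apply: down => // m' _.
  apply/eqP => /esym/(theta_at_inj c_in)[ii _].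
  by have := ordS_neq i0 (ltnW t3); rewrite -ii eqxx.
have V2 : 2 < #|theta_vertex p|.
  pose i : 'I_t := Ordinal (leq_trans (isT : 0 < 3) t3).
  have := uniq_leq_size (s1 := [:: inl false; inl true; at_ i 1]) (s2 := enum (theta_vertex p)).
  rewrite -cardE; apply => // [|x _]; last by rewrite mem_enum.
  by rewrite (theta_at_in (p_gt0 i)).
split=> // x y; have [c] : exists c, c \in ~: [set x; y].
  apply/card_gt0P; have := cardsC [set x; y]; have := cards2 x y; lia.
rewrite !inE negb_or !(eq_sym c) => /andP[xc yc].
by apply: connect_sub (bic c x y xc yc) => a b /and3P[ab _ _]; exact: connect1.
Qed.

Definition theta_face (i : 'I_t) : {set theta_vertex p} :=
  [set x | if x is inr a then (tag a == i) || (tag a == ord_pred i) else true].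

Lemma theta_at_face i i' j : i = i' \/ i = ord_pred i' -> at_ i j \in theta_face i'.
Proof.
by rewrite inE; case: j => //= j; case: insubP => //= b _ _ [] ->; rewrite eqxx ?orbT.
Qed.

Let ring_pred i j : j <= (p (ord_pred i)).+1 -> ring i (k - j) = at_ (ord_pred i) j.
Proof. by move=> le_j; rewrite -ring_back ?ord_predK. Qed.

Lemma theta_face_ring i : theta_face i = [set ring i m | m : 'I_k].
Proof.
have E := pE i; have Ep := p_gt0 (ord_pred i).
have ringP m : m < k -> ring i m \in [set ring i m | m : 'I_k].
  by move=> lt_m; apply/imsetP; exists (Ordinal lt_m).
apply/setP => x; apply/idP/idP; last first.
  case/imsetP=> m _ ->; rewrite /theta_ring.
  by case: leqP => _; apply: theta_at_face; [left|right].
rewrite inE; case: x => [[] _|[j [a lt_a]] /= /orP[]/eqP ji].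
- by rewrite -(ring_top i); apply: ringP; lia.
- by rewrite -(ring0 i); apply: ringP; lia.
- subst j; rewrite -(theta_at_in lt_a) -ring_at; last by lia.
  by apply: ringP; lia.
- subst j; rewrite -(theta_at_in lt_a) -ring_pred; last by lia.
  by apply: ringP; lia.
Qed.

Let ring_inj i m m' : m < k -> m' < k -> ring i m = ring i m' -> m = m'.
Proof.
wlog le_m : m m' / m <= m'.
  by move=> W lm lm'; case: (leqP m m') => [/W|/ltnW/W] H; [exact: H|move/esym/H => ->].
move=> lm lm' E; have Ek := pE i; have [le_p|gt_p] := leqP m' (p i).+1.
  by move: E; rewrite !ring_at //; [apply: theta_at_inj1|]; lia.
have m'E : ring i m' = at_ (ord_pred i) (k - m').
  by rewrite -ring_pred ?subKn //; lia.
have [le_mp|gt_mp] := leqP m (p i).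
  rewrite m'E ring_at in E; last by lia.
  have j_in : 0 < k - m' <= p (ord_pred i) by lia.
  have [ii _] := theta_at_inj j_in (esym E).
  by have := ordS_neq (ord_pred i) (ltnW t3); rewrite ord_predK ii eqxx.
have mE : ring i m = at_ (ord_pred i) (k - m).
  by rewrite -ring_pred ?subKn //; lia.
rewrite mE m'E in E; have /theta_at_inj1 := E; lia.
Qed.

Lemma card_theta_face i : #|theta_face i| = k.
Proof.
rewrite theta_face_ring card_imset ?card_ord // => m m' /ring_inj E.
by apply: val_inj; apply: E.
Qed.

(** Two different indices with the same face would each be the cyclic predecessor of the other, so a
    shift by two would have a fixed point, which t >= 3 forbids. *)
Lemma theta_face_inj : injective theta_face.
Proof.
move=> i j /setP E; have Ei := E (at_ i 1); have Ep := E (at_ (ord_pred i) 1).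
rewrite theta_at_face in Ei; last by left.
rewrite theta_at_face in Ep; last by right.
rewrite (theta_at_in (p_gt0 _)) inE /= in Ei; rewrite (theta_at_in (p_gt0 _)) inE /= in Ep.
case/esym/orP: Ei => /eqP // ij; case/esym/orP: Ep => /eqP pj; last first.
  by rewrite -(ord_predK i) pj ord_predK.
by have := ordS2_neq (ord_pred i) t3; rewrite ord_predK {1}ij ord_predK pj eqxx.
Qed.

Let face_of_start i : face_of (theta p) (start i) =
  [set (ring i m, ring i m.+1) | m : 'I_k].
Proof.
apply/setP => d; rewrite inE; apply/idP/imsetP.
  case/(fconnect_period (ltnW (ltnW k_gt2)) (iter_face_k i)) => m lt_m ->.
  by exists (Ordinal lt_m); rewrite // iter_face.
by case=> m _ ->; rewrite -iter_face //; exact: fconnect_iter.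
Qed.

Let face_start_vertices i : face_vertices (face_of (theta p) (start i)) = theta_face i.
Proof. by rewrite theta_face_ring face_of_start /face_vertices -imset_comp. Qed.

Lemma theta_facesE : faces (theta p) = [set face_of (theta p) (start i) | i : 'I_t].
Proof.
apply/setP => F; apply/facesP/imsetP.
  case=> -[x y]; rewrite in_darts => /theta_dart_face[i [m [lt_m xyE]]] ->.
  exists i => //; apply: (face_of_eq theta_simple theta_rotation).
    by rewrite in_darts; apply: (ring_adj i (m := 0)); lia.
  by rewrite inE xyE fconnect_iter.
case=> i _ ->; exists (start i) => //; rewrite in_darts; apply: (ring_adj i (m := 0)); lia.
Qed.

Lemma theta_face_hypergraph : face_hypergraph (theta p) = [set theta_face i | i : 'I_t].
Proof.
rewrite /face_hypergraph theta_facesE -imset_comp; apply: eq_imset => i /=.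
exact: face_start_vertices.
Qed.

Lemma card_theta_faces : #|faces (theta p)| = t.
Proof.
rewrite theta_facesE card_imset ?card_ord // => i j E.
by apply: theta_face_inj; rewrite -!face_start_vertices E.
Qed.

Lemma theta_bounded F : F \in faces (theta p) -> bounded_by_cycle k F.
Proof.
rewrite theta_facesE => /imsetP[i _ ->].
have inj : {in face_of (theta p) (start i) &, injective fst}.
  move=> d d'; rewrite face_of_start => /imsetP[m _ ->] /imsetP[m' _ ->] /=.
  by move=> E; rewrite (ring_inj (ltn_ord m) (ltn_ord m') E).
split=> //; rewrite -(card_in_imset inj).
by rewrite -/(face_vertices _) face_start_vertices card_theta_face.
Qed.

Lemma sum_theta_lengths : 2 * \sum_i p i = t * (k - 2).
Proof.
have -> : t * (k - 2) = \sum_(i < t) (p i + p (ordS i)).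
  rewrite (eq_bigr (fun=> k - 2)); last by case: p_bal.
  by rewrite sum_nat_const card_ord.
rewrite big_split /= mul2n -addnn; congr (_ + _).
exact: (reindex_inj (can_inj (@ordSK t))).
Qed.

Lemma card_theta_vertex : #|theta_vertex p| = 2 + \sum_i p i.
Proof.
rewrite card_sum card_bool card_tagged sumnE big_map big_enum /=.
by congr (_ + _); apply: eq_bigr => i _; rewrite card_ord.
Qed.

(** For Euler's formula, kt is twice the number of edges, and the paths have t(k - 2)/2 internal
    vertices in all. *)
Lemma theta_angulation : closed_angulation (theta p) k.
Proof.
split; [|exact: theta_biconnected|exact: theta_bounded].
have [_ con _] := theta_biconnected.
split=> //; [exact: theta_simple|exact: theta_rotation|].
have := card_uniform_partition (fun F FF => (theta_bounded FF).1)
  (faces_partition theta_simple theta_rotation).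
rewrite (card_darts_edges theta_simple) card_theta_faces card_theta_vertex.
have := sum_theta_lengths; nia.
Qed.
End Theta.

(** * Angulations all of whose faces share two vertices *)

Section Structure.
Variables (V : finType) (G : embedding V) (k : nat) (u w : V).
Hypothesis G_ang : closed_angulation G k.
Hypothesis uw : u != w.
Hypothesis k_gt2 : 2 < k.
Hypothesis t_ge3 : 3 <= #|faces G|.
Hypothesis faces_uw : forall F, F \in faces G ->
  u \in face_vertices F /\ w \in face_vertices F.
Hypothesis deg2 : forall v, v != u -> v != w -> #|nbrs G v| = 2.

Notation t := #|faces G|.
Let GS := angulation_simple G_ang.
Let GR := angulation_rot G_ang.
Let adj_sym : symmetric (adj G). Proof. by case: GS. Qed.
Notation f := (face_next G).
Notation r := (Defs.rot G).
Let f_in := face_next_darts GS GR.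
Let f_inj := face_next_inj GS GR.

Let rot_rot v z : v != u -> v != w -> adj G v z -> r v (r v z) = z.
Proof.
move=> vu vw vz; have zN : z \in nbrs G v by rewrite inE.
have rN := rot_nbrs GR zN; have rrN := rot_nbrs GR rN.
have rz : r v z != z.
  apply/eqP => rz; have : #|nbrs G v| <= #|[set z]|.
    apply/subset_leq_card/subsetP => z' z'N; rewrite inE eq_sym.
    have /iter_findex <- := rot_connect GR zN z'N.
    by elim: (findex _ _ _) => //= n /eqP <-; rewrite rz.
  by rewrite deg2 // cards1.
have : r v (r v z) \in [set z; r v z].
  suff <- : nbrs G v = [set z; r v z] by [].
  apply/esym/eqP; rewrite eqEcard deg2 // cards2 eq_sym rz andbT.
  by apply/subsetP => x; rewrite in_set2 => /orP[]/eqP->.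
rewrite !inE => /orP[/eqP//|/eqP /(rotation_inj GR rN zN) E].
by rewrite E eqxx in rz.
Qed.

(** Every face passes through [u] exactly once, so y is sent bijectively to the face of the dart
    [(u, y)]. *)
Let card_nbrs_u : #|nbrs G u| = t.
Proof.
have inj : {in nbrs G u &, injective (fun y => face_of G (u, y))}.
  move=> y z; rewrite !inE => uy uz E.
  have yD : (u, y) \in darts G by rewrite inE.
  have FF : face_of G (u, y) \in faces G by apply/facesP; exists (u, y).
  suff [] : (u, y) = (u, z) by [].
  apply: (face_fst_inj G_ang FF) => //; first exact: mem_face_of.
  by rewrite E mem_face_of.
rewrite -(card_in_imset inj); congr #|pred_of_set _|; apply/setP => F.
apply/imsetP/idP => [[y] |FF].
  by rewrite inE => uy ->; apply/facesP; exists (u, y); rewrite // inE.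
have [/imsetP[[x y] dF /= ->] _] := faces_uw FF.
exists y; last exact: face_eq.
by have := subsetP (face_sub GS GR FF) _ dF; rewrite !inE.
Qed.

Let y0_ex : exists y, y \in nbrs G u.
Proof. by apply/card_gt0P; rewrite card_nbrs_u; lia. Qed.

Let y0 := xchoose y0_ex.
(** The neighbours of [u] in rotation order, indexed periodically by natural numbers so that the
    next one is always m + 1. *)
Let y m := iter m (r u) y0.

Let y_nbr m : y m \in nbrs G u.
Proof. by elim: m => [|m IH]; [exact: xchooseP|exact: (rot_nbrs GR IH)]. Qed.

Let order_y0 : order (r u) y0 = t.
Proof.
rewrite -card_nbrs_u; apply: eq_card => z; rewrite inE; apply/idP/idP.
  by move=> /iter_findex <-; exact: y_nbr.
by move=> zN; apply: (rot_connect GR) => //; exact: (y_nbr 0).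
Qed.

Let y_period m : y (m %% t) = y m.
Proof.
rewrite {2}(divn_eq m t) addnC /y iterD; congr iter.
elim: (m %/ t) => //= q IH; rewrite mulSn iterD -IH -order_y0.
by rewrite (iter_order_in (rot_nbrs GR (x:=u)) (rotation_inj GR (x:=u)) (y_nbr 0)).
Qed.

Let y_inj m m' : m < t -> m' < t -> y m = y m' -> m = m'.
Proof.
rewrite -order_y0 => lm lm' E.
by rewrite -(findex_iter lm) -(findex_iter lm') -/(y m) E.
Qed.

Let y_surj z : adj G u z -> exists2 m, m < t & z = y m.
Proof.
move=> uz; have zN : z \in nbrs G u by rewrite inE.
have c := rot_connect GR (y_nbr 0) zN; exists (findex (r u) y0 z).
  by rewrite -order_y0; exact: findex_max.
by rewrite /y iter_findex.
Qed.

Let start m : V * V := (u, y m).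
Let a m j : V := (iter j f (start m)).1.

Let startD m : start m \in darts G.
Proof. by have := y_nbr m; rewrite !inE. Qed.

Let iterD_ m j : iter j f (start m) \in darts G.
Proof. by elim: j => [|j IH]; [exact: startD|exact: f_in IH]. Qed.

Let iter_a m j : iter j f (start m) = (a m j, a m j.+1).
Proof. by rewrite /a iterS [iter j f _]surjective_pairing. Qed.

Let face_start m : face_of G (start m) \in faces G.
Proof. by apply/facesP; exists (start m). Qed.

Let order_start m : order f (start m) = k.
Proof.
rewrite -(card_face G_ang (face_start m)); apply: eq_card => d.
by rewrite [RHS]inE.
Qed.

Let iter_k m : iter k f (start m) = start m.
Proof. by rewrite -(order_start m) (iter_order_in f_in f_inj (startD m)). Qed.

Let a_k m : a m k = u. Proof. by rewrite /a iter_k. Qed.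

Let a_inj m j j' : j < k -> j' < k -> a m j = a m j' -> j = j'.
Proof.
move=> lj lj' E; have /(congr1 (findex f (start m))) : iter j f (start m) = iter j' f (start m).
  by apply: (face_fst_inj G_ang (face_start m)); rewrite // inE fconnect_iter.
by rewrite !findex_iter ?order_start.
Qed.

Let face_start_vertices m : face_vertices (face_of G (start m)) = [set a m j | j : 'I_k].
Proof.
apply/setP => v; apply/imsetP/imsetP => [[d]|[j _ ->]].
  rewrite inE => /(fconnect_period (ltnW (ltnW k_gt2)) (iter_k m))[j lj ->] ->.
  by exists (Ordinal lj).
by exists (iter j f (start m)); rewrite // inE fconnect_iter.
Qed.

Let w_ex m : exists j : 'I_k, w == a m j.
Proof.
have [_] := faces_uw (face_start m); rewrite face_start_vertices.
by case/imsetP=> j _ ->; exists j.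
Qed.

(** The number of vertices strictly between [u], at position 0, and [w] on the face leaving [u]
    towards [y m]. *)
Let p m := (xchoose (w_ex m)).-1.

Let p_bound m : (p m).+1 < k.
Proof. by rewrite /p; have := ltn_ord (xchoose (w_ex m)); lia. Qed.

Let a_w m : a m (p m).+1 = w.
Proof.
have /eqP wE := xchooseP (w_ex m); rewrite /p prednK; first by rewrite -wE.
rewrite lt0n; apply: contra uw => /eqP j0; rewrite wE j0; exact: eqxx.
Qed.

Let a_mid m j : 0 < j <= p m -> a m j != u /\ a m j != w.
Proof.
move=> jp; have pb := p_bound m; split; apply/eqP => E.
  have E0 : a m j = a m 0 by rewrite E.
  by have := a_inj (_ : j < k) (_ : 0 < k) E0; lia.
by rewrite -(a_w m) in E; have := a_inj (_ : j < k) pb E; lia.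
Qed.

(* Inner vertices of the [m]-th path have degree 2, so reversing that path stays
   on one face, the one that leaves [u] along the next path. *)
Let iter_back m j : j <= p m ->
  iter (k.-1 - j) f (start m.+1) = (a m j.+1, a m j).
Proof.
have pb := p_bound m.
have adj_a i : adj G (a m i) (a m i.+1).
  by have := iterD_ m i; rewrite iter_a inE.
have bD i : (a m i.+1, a m i) \in darts G by rewrite inE /= adj_sym.
elim: j => [_|j IH lt_j]; apply: f_inj; rewrite ?bD ?iterD_ // -iterS.
  rewrite subn0 prednK; last by lia.
  by rewrite iter_k.
have -> : (k.-1 - j.+1).+1 = k.-1 - j by lia.
rewrite IH ?(ltnW lt_j) //; have [au aw] := @a_mid m j.+1 lt_j.
have : f (iter j f (start m)) = iter j.+1 f (start m) by [].
rewrite !iter_a => /(congr1 snd)/= E; rewrite /face_next /= -E rot_rot //.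
by rewrite adj_sym; exact: adj_a.
Qed.

Let a_back m j : j <= (p m).+1 -> a m.+1 (k - j) = a m j.
Proof.
case: j => [|j] le_j; first by rewrite subn0 a_k.
by have -> : k - j.+1 = k.-1 - j by [lia]; rewrite /a iter_back.
Qed.

(** The face m + 1 meets [w] only once: after p(m + 1) internal vertices going forward, and after
    p(m) going backward. *)
Let p_next m : p m + p m.+1 = k - 2.
Proof.
have pb := p_bound m; have pb' := p_bound m.+1.
have E : a m.+1 (k - (p m).+1) = a m.+1 (p m.+1).+1 by rewrite a_back // !a_w.
by have := a_inj (_ : k - (p m).+1 < k) pb' E; lia.
Qed.

Let start_period m m' : m = m' %[mod t] -> start m = start m'.
Proof. by move=> E; rewrite /start -y_period E y_period. Qed.

Let p_period m m' : m = m' %[mod t] -> p m = p m'.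
Proof.
move=> E; have aE j : a m j = a m' j by rewrite /a (start_period E).
have := a_w m'; rewrite -aE -(a_w m) => H.
by have := a_inj (p_bound m') (p_bound m) H; lia.
Qed.

(** If p(m) = 0, then p(m + 2) = 0, so y(m) and y(m + 2) are both [w], although they differ for t >=
    3. *)
Let p_gt0 m : 0 < p m.
Proof.
rewrite lt0n; apply/eqP => p0; have := p_next m; have := p_next m.+1; rewrite p0 => E1 E2.
have p2 : p m.+2 = 0 by lia.
have yw n : p n = 0 -> y n = w by move=> pn; rewrite -(a_w n) pn.
have E : y (m %% t) = y (m.+2 %% t) by rewrite !y_period !yw.
have := y_inj (_ : m %% t < t) (_ : m.+2 %% t < t) E.
rewrite !ltn_pmod; try lia; move=> /(_ isT isT) /esym/eqP.
rewrite -addn2 -{2}[m]addn0 eqn_modDl mod0n modn_small; lia.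
Qed.

Let P (i : 'I_t) := p i.

Let P_ordS (i : 'I_t) : p (ordS i) = p i.+1.
Proof. by apply: p_period; rewrite /= modn_mod. Qed.

Let P_bal : balanced P k.
Proof. by split=> // i; rewrite /P ?P_ordS ?p_next. Qed.

Let g (x : theta_vertex P) : V :=
  match x with
  | inl b => if b then w else u
  | inr s => a (tag s) (tagged s).+1
  end.

Let g_at (i : 'I_t) j : j <= (P i).+1 -> g (theta_at P i j) = a i j.
Proof.
case: j => [//|j]; rewrite leq_eqVlt => /predU1P[->|lt_j].
  by rewrite theta_at_end /= a_w.
by rewrite (theta_at_in (p := P) (i := i) lt_j).
Qed.

Let g_ring (i : 'I_t) m : m < k -> g (theta_ring k P i m) = a i m.
Proof.
move=> lt_m; rewrite /theta_ring; case: leqP => [le_m|gt_m]; first by rewrite g_at // leqW.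
have := p_next (ord_pred i); rewrite -P_ordS ord_predK => E.
rewrite g_at; last by rewrite /P; move: gt_m; rewrite /P; lia.
rewrite -a_back; last by move: gt_m; rewrite /P; lia.
rewrite subKn ?(ltnW lt_m) // /a; congr (iter _ _ _).1; apply: start_period.
by have /(congr1 (@nat_of_ord t)) := ord_predK i; move=> /= {2}<-; rewrite modn_mod.
Qed.

Let g_face i : g @: theta_face P i = face_vertices (face_of G (start i)).
Proof.
rewrite (theta_face_ring P_bal) face_start_vertices -imset_comp.
by apply: eq_imset => m /=; rewrite g_ring.
Qed.

Let faceE F : F \in faces G -> exists i : 'I_t, F = face_of G (start i).
Proof.
move=> FF; have [/imsetP[[x z] dF /= uE] _] := faces_uw FF; subst x.
have := subsetP (face_sub GS GR FF) _ dF; rewrite in_darts => /y_surj[m lt_m zE].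
by exists (Ordinal lt_m); rewrite /= /start -zE; exact: face_eq.
Qed.

Let g_surj v : exists x, g x = v.
Proof.
have [F FF vF] : exists2 F, F \in faces G & v \in face_vertices F.
  have [->|vu] := eqVneq v u.
    by exists (face_of G (start 0)); rewrite ?face_start //; have [] := faces_uw (face_start 0).
  have [->|vw] := eqVneq v w.
    by exists (face_of G (start 0)); rewrite ?face_start //; have [] := faces_uw (face_start 0).
  have /card_gt0P[z] : 0 < #|nbrs G v| by rewrite deg2.
  rewrite inE => vz; exists (face_of G (v, z)).
    by apply/facesP; exists (v, z); rewrite ?in_darts.
  by apply/imsetP; exists (v, z); rewrite ?mem_face_of.
have [i FE] := faceE FF; move: vF; rewrite FE -g_face => /imsetP[x _ ->].
by exists x.
Qed.

(** Every vertex lies on a face, so [g] is onto; by Euler's formula both vertex sets have the same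
    size. *)
Let g_bij : bijective g.
Proof.
have cV : #|theta_vertex P| = #|V|.
  have := sum_theta_lengths P_bal; have := angulation_euler G_ang.
  rewrite card_theta_vertex; nia.
have gT : g @: [set: theta_vertex P] = [set: V].
  by apply/setP => v; rewrite inE; have [x <-] := g_surj v; rewrite imset_f ?inE.
have /imset_injP inj : #|g @: [set: theta_vertex P]| == #|[set: theta_vertex P]|.
  by rewrite gT !cardsT cV.
apply: inj_card_bij; last by rewrite cV.
by move=> x z; apply: inj; rewrite inE.
Qed.

Lemma theta_structure : exists (t : nat) (p : 'I_t -> nat),
  balanced p k /\ hypergraph_iso (face_hypergraph (theta p)) (face_hypergraph G).
Proof.
exists t, P; split; first exact: P_bal.
exists g; first exact: g_bij.
rewrite (theta_face_hypergraph P_bal) -imset_comp; apply/setP => E; apply/imsetP/imsetP.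
  by case=> F /faceE[i ->] ->; exists i => //=; rewrite g_face.
by case=> i _ ->; exists (face_of G (start i)); rewrite ?face_start //= g_face.
Qed.
End Structure.

(** * Transport along a bijection *)

Lemma connect_homo (S T : finType) (e : rel S) (e' : rel T) (h : S -> T) a b :
  (forall x y, e x y -> e' (h x) (h y)) -> connect e a b -> connect e' (h a) (h b).
Proof.
move=> eh /connectP[q]; elim: q a => [|c q IH] a /=; first by move=> _ ->.
by case/andP=> ac qc bE; apply: connect_trans (connect1 (eh _ _ ac)) (IH c qc bE).
Qed.

Section Transport.
Variables (V W : finType) (G : embedding V) (k : nat) (f : V -> W) (g : W -> V).
Hypotheses (fK : cancel f g) (gK : cancel g f).
Hypothesis G_ang : closed_angulation G k.

(** Used to move [theta], whose vertices form a sum type, onto ['I_n]. *)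
Definition transport : embedding W :=
  Embedding (fun x y => adj G (g x) (g y)) (fun x y => f (Defs.rot G (g x) (g y))).

Let GS := angulation_simple G_ang.
Let GR := angulation_rot G_ang.
Let ff (d : V * V) := (f d.1, f d.2).
Let gg (d : W * W) := (g d.1, g d.2).
Let ffK : cancel ff gg. Proof. by case=> x y; rewrite /gg /= !fK. Qed.
Let ggK : cancel gg ff. Proof. by case=> x y; rewrite /ff /= !gK. Qed.

Let mem_ff (A : {set V * V}) d : (d \in ff @: A) = (gg d \in A).
Proof. by rewrite -{1}(ggK d) mem_imset //; exact: can_inj ffK. Qed.

Let ff_set_inj : injective (fun A : {set V * V} => ff @: A).
Proof. exact: imset_inj (can_inj ffK). Qed.

Let tr_simple : simple_graph transport.
Proof.
case: GS => sym irr; split=> [x y|x] /=; first exact: sym.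
exact: irr.
Qed.

Let tr_rot : rotation_system transport.
Proof.
move=> x y /= xy; have [xr con] := GR xy; split=> /=; first by rewrite fK.
move=> z xz; rewrite -(gK y) -(gK z); apply: fconnect_homo (con _ xz) => a /=.
by rewrite fK.
Qed.

Let tr_face_next d : face_next transport (ff d) = ff (face_next G d).
Proof. by rewrite /face_next /ff /= !fK. Qed.

Let tr_face_of d : face_of transport d = ff @: face_of G (gg d).
Proof.
apply/setP => e; rewrite mem_ff !inE; apply/idP/idP.
  by apply: fconnect_homo => x; rewrite -{2}(ggK x) tr_face_next ffK.
by rewrite -{2}(ggK d) -{2}(ggK e); exact: fconnect_homo tr_face_next.
Qed.

Let tr_faces : faces transport = [set ff @: F | F : {set V * V} in faces G].
Proof.
apply/setP => F; apply/imsetP/imsetP => [[d dA ->]|[_ /imsetP[d dA ->] ->]].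
  exists (face_of G (gg d)); last exact: tr_face_of.
  by apply/imsetP; exists (gg d) => //; move: dA; rewrite ?inE.
exists (ff d); last by rewrite tr_face_of ffK.
by move: dA; rewrite !inE /= !fK.
Qed.

Lemma transport_face_hypergraph :
  face_hypergraph transport = [set [set f v | v in (e : {set V})] | e in face_hypergraph G].
Proof.
rewrite /face_hypergraph tr_faces -!imset_comp; apply: eq_imset => F /=.
by rewrite /face_vertices -!imset_comp.
Qed.

Lemma transport_angulation : closed_angulation transport k.
Proof.
have [[_ _ con euler] [V2 _ bic] bnd] := G_ang.
have cVW : #|V| = #|W| by apply: bij_eq_card; exists g.
have tcon : connected_graph transport.
  move=> x y; rewrite -(gK x) -(gK y); apply: connect_homo (con (g x) (g y)) => a b /=.
  by rewrite !fK.
split.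
- split=> //; rewrite tr_faces (card_imset _ ff_set_inj) -cVW euler; congr (_ + _).
  apply/eqP; rewrite -(eqn_pmul2l (isT : 0 < 2)) -!card_darts_edges //.
  rewrite (_ : darts transport = ff @: darts G) ?card_imset //; first exact: can_inj ffK.
  by apply/setP => d; rewrite mem_ff !inE.
- split=> //; first by rewrite -cVW.
  move=> c x y xc yc; rewrite -(gK x) -(gK y).
  have ne z : z != c -> g z != g c by rewrite (inj_eq (can_inj gK)).
  apply: connect_homo (bic _ _ _ (ne x xc) (ne y yc)) => a b /and3P[ab ac bc] /=.
  by rewrite !fK ab -(gK c) !(inj_eq (can_inj fK)) ac.
- move=> F; rewrite tr_faces => /imsetP[A /bnd[cA iA] ->]; split.
    by rewrite card_imset //; exact: can_inj ffK.
  move=> _ _ /imsetP[d dA ->] /imsetP[e eA ->] /(can_inj fK) E.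
  by rewrite (iA _ _ dA eA E).
Qed.
End Transport.

(** * Balanced path lengths for every admissible order *)

Definition alternating_lengths (k t : nat) (i : 'I_t) : nat :=
  (k - 2)./2 + (odd (k - 2) && odd i).

(** For even k all lengths are (k - 2)/2. For odd k they alternate between the two nearest integers,
    which closes up cyclically because (k - 2)t is even, hence t is. *)
Lemma alternating_balanced k t n : 4 <= k -> 3 <= t -> (k - 2) * t = 2 * n ->
  balanced (@alternating_lengths k t) k.
Proof.
move=> k4 t3 E; split=> // i; rewrite /alternating_lengths; first by lia.
have [ok|ek] := boolP (odd (k - 2)); last by lia.
have et : ~~ odd t by move: ok; have := congr1 odd E; rewrite !oddM /=; lia.
suff -> : odd (ordS i) = ~~ odd i by lia.
rewrite /=; have [lt|ge] := ltnP i.+1 t; first by rewrite modn_small.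
have -> : i.+1 = t by have := ltn_ord i; lia.
by rewrite modnn; have := ltn_ord i; lia.
Qed.

(** * Corner weights *)

Section CornerCounts.
Variables (V C : finType) (D : {set C}) (P : {set {set C}}) (ver : C -> V).
Variables (lat : pred C) (u w : V).
Hypothesis P_part : partition P D.
Hypothesis ver_inj : forall e, e \in P -> {in e &, injective ver}.
Hypothesis extremal2 : forall e, e \in P -> #|[set c in e | ~~ lat c]| = 2.
Hypothesis lateral2 : forall v, v != u -> v != w ->
  #|[set c in D | (ver c == v) && lat c]| = 2.

(** The number q(v) of extremal corners. Corners are abstract here: [P] groups them by face and
    [ver] gives their vertex. They will be darts, taken at their end vertex. *)
Definition ext_deg v := #|[set c in D | (ver c == v) && ~~ lat c]|.

Lemma corner_block c : c \in D -> (pblock P c \in P) /\ (c \in pblock P c).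
Proof.
case/and3P: P_part => /eqP cov tP _ cD.
by split; [apply: pblock_mem|]; rewrite ?mem_pblock cov.
Qed.

Lemma block_corner e c : e \in P -> c \in e -> c \in D /\ pblock P c = e.
Proof.
case/and3P: P_part => /eqP cov tP _ eP ce; split; last exact: def_pblock tP eP ce.
by rewrite -cov; apply/bigcupP; exists e.
Qed.

Lemma corners_at_blocks v (X : pred {set C}) :
  #|[set c in D | (ver c == v) && X (pblock P c)]| <= #|[set e in P | X e]|.
Proof.
rewrite -(card_in_imset (f := pblock P)).
  apply/subset_leq_card/subsetP => _ /imsetP[c + ->]; rewrite !inE.
  by case/and3P=> /corner_block[-> _] _ ->.
move=> c d; rewrite !inE => /and3P[cD /eqP cv _] /and3P[dD /eqP dv _] E.
have [pP cp] := corner_block cD; have [_ dp] := corner_block dD.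
by rewrite -E in dp; apply: (ver_inj pP) => //; rewrite cv dv.
Qed.

Lemma sum_ext_deg : \sum_v ext_deg v = 2 * #|P|.
Proof.
transitivity #|[set c in D | ~~ lat c]|.
  rewrite -sum1_card (partition_big ver predT) //=; apply: eq_bigr => v _.
  rewrite /ext_deg -sum1_card; apply: eq_bigl => c; rewrite !inE -andbA.
  by rewrite (andbC (~~ _)).
case/and3P: P_part => /eqP cov tP _; rewrite -sum1_card.
rewrite (eq_bigl (fun c => (c \in cover P) && ~~ lat c)); last by move=> c; rewrite inE cov.
rewrite big_trivIset_cond //= mulnC -sum_nat_const; apply: eq_bigr => e eP.
by rewrite -(extremal2 eP) -sum1_card; apply: eq_bigl => c; rewrite !inE.
Qed.

Lemma ext_deg_le v : ext_deg v <= #|P|.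
Proof.
apply: leq_trans (_ : #|[set e in P | predT e]| <= _); last first.
  by apply/subset_leq_card/subsetP => e; rewrite inE => /andP[].
apply: leq_trans (corners_at_blocks v predT).
by apply/subset_leq_card/subsetP => c; rewrite !inE andbT => /and3P[-> ->].
Qed.

(** Each vertex of [S] has two lateral corners, and each corner lies in a single face. *)
Lemma lateral_blocks (S : pred V) : (forall v, S v -> v != u /\ v != w) ->
  #|[set e in P | [exists c in e, lat c && S (ver c)]]| <= 2 * #|[set v | S v]|.
Proof.
move=> Suw; apply: (@leq_trans #|[set c in D | lat c && S (ver c)]|).
  apply: leq_trans (leq_imset_card (pblock P) _).
  apply/subset_leq_card/subsetP => e; rewrite inE => /andP[eP /exists_inP[c ce lS]].
  have [cD pc] := block_corner eP ce; rewrite -pc; apply: imset_f.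
  by rewrite inE cD.
rewrite -sum1_card (partition_big ver S) /=; last by move=> c; rewrite inE => /and3P[].
rewrite mulnC -sum_nat_const; rewrite [X in _ <= X](eq_bigl S); last by move=> v; rewrite inE.
apply: leq_sum => v Sv; have [vu vw] := Suw v Sv; rewrite -(lateral2 vu vw) -sum1_card.
by rewrite leq_eqVlt (eq_bigl (mem [set c in D | (ver c == v) && lat c])) ?eqxx // => c;
  rewrite !inE; case: eqP => [->|]; rewrite ?Sv ?andbT ?andbF.
Qed.

Hypothesis uw : u != w.
Hypothesis ext_u : forall v, v != u -> v != w -> ext_deg v <= ext_deg u.
Hypothesis ext_w : forall v, v != u -> v != w -> ext_deg v <= ext_deg w.

Lemma sum_ext_deg_other :
  ext_deg u + ext_deg w + \sum_(v | (v != u) && (v != w)) ext_deg v = 2 * #|P|.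
Proof.
by rewrite -sum_ext_deg [RHS](bigD1 u) //= [X in _ = _ + X](bigD1 w) 1?eq_sym //= addnA.
Qed.

(** If one extremity had extremal degree 0, so would all other vertices by maximality, and the
    remaining extremity would have to supply 2|P| with at most |P|. *)
Lemma ext_deg_extremity_gt0 : 0 < #|P| -> 0 < ext_deg u /\ 0 < ext_deg w.
Proof.
move=> P0; have := sum_ext_deg_other; have := ext_deg_le u; have := ext_deg_le w.
move=> lw lu E; split; rewrite lt0n; apply/eqP => z.
  have : \sum_(v | (v != u) && (v != w)) ext_deg v = 0.
    by apply: big1 => v /andP[vu vw]; have := ext_u vu vw; lia.
  lia.
have : \sum_(v | (v != u) && (v != w)) ext_deg v = 0.
  by apply: big1 => v /andP[vu vw]; have := ext_w vu vw; lia.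
lia.
Qed.

Lemma ext_deg_other x : x != u -> x != w ->
  ext_deg x + ext_deg u + ext_deg w <= 2 * #|P|.
Proof.
move=> xu xw; have := sum_ext_deg_other; rewrite (bigD1 x) ?xu //=; lia.
Qed.

Lemma ext_deg_other2 x y : x != u -> x != w -> y != u -> y != w -> x != y ->
  ext_deg x + ext_deg y + ext_deg u + ext_deg w <= 2 * #|P|.
Proof.
move=> xu xw yu yw xy; have := sum_ext_deg_other.
rewrite (bigD1 x) ?xu //= (bigD1 y) ?yu ?yw 1?eq_sym //=; lia.
Qed.

Lemma card_other_ext (S : pred V) (m : nat) : (forall v, S v -> v != u /\ v != w) ->
  (forall v, S v -> m <= ext_deg v) ->
  m * #|[set v | S v]| + ext_deg u + ext_deg w <= 2 * #|P|.
Proof.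
move=> Suw Sm; have := sum_ext_deg_other; suff : m * #|[set v | S v]| <=
  \sum_(v | (v != u) && (v != w)) ext_deg v by lia.
rewrite mulnC -sum_nat_const [leqRHS](bigID S) /=; apply: leq_trans (leq_addr _ _).
rewrite [leqRHS](eq_bigl (mem [set v | S v])) => [|v].
  by apply: leq_sum => v; rewrite inE; exact: Sm.
rewrite !inE; have [Sv|_] := boolP (S v); last by rewrite andbF.
by have [-> ->] := Suw v Sv.
Qed.

End CornerCounts.

Local Open Scope ring_scope.

(** * Numerical inequalities for extremal degrees *)

Lemma bernoulli_le (R : realFieldType) (x : R) m : 0 <= x <= 1 -> 1 - m%:R * x <= (1 - x) ^+ m.
Proof.
case/andP=> x0 x1; elim: m => [|m IH]; first by rewrite mul0r subr0 expr0.
rewrite exprS -natr1; apply: le_trans (_ : (1 - x) * (1 - m%:R * x) <= _); last first.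
  by apply: ler_wpM2l => //; lra.
have : 0 <= m%:R * x * x by rewrite !mulr_ge0.
lra.
Qed.

Section Numerics.
Variables (R : realFieldType) (T qu qw kap : R).
Hypotheses (T_gt0 : 0 < T) (qu_gt0 : 0 < qu) (qu_le : qu <= T).
Hypotheses (qw_gt0 : 0 < qw) (qw_le : qw <= T).
Hypothesis kapE : kap = 48%:R^-1.
Let Dlt := 2 * T - qu - qw.

(** With [kap] = 1/48 the two additions amount to an eighth of [Dlt], so the factors sum to 2T -
    (7/8) [Dlt]; AM-GM does the rest. *)
Lemma extremity_product : 0 < Dlt ->
  (qu + 3 * kap * Dlt) * (qw + 3 * kap * Dlt) < T ^+ 2.
Proof.
have [? ? ? ? ?] := And5 T_gt0 qu_gt0 qu_le qw_gt0 qw_le; rewrite kapE => D0.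
have agm (a b : R) : 4 * (a * b) <= (a + b) ^+ 2.
  have := sqr_ge0 (a - b); lra.
have := agm (qu + 3 * 48%:R^-1 * Dlt) (qw + 3 * 48%:R^-1 * Dlt).
set S := _ + (_ + _) => H.
have S0 : 0 <= S by rewrite /S; lra.
have SE : S = 2 * T - (7%:R / 8%:R) * Dlt by rewrite /S /Dlt; field.
have : S ^+ 2 < (2 * T) ^+ 2 by apply: ltrXn2r; rewrite ?nnegrE //; lra.
lra.
Qed.

(** For faces with one extremal corner at an extremity. Here q <= T - qu/2, and the first factor is
    at most qu + T/8. *)
Lemma extremity_other_product q : 0 <= q -> q + qu + qw <= 2 * T -> q <= qw ->
  (qu + 3 * kap * Dlt) * Num.max q (T / 4%:R) <= 5%:R / 8%:R * T ^+ 2.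
Proof.
have [? ? ? ? ?] := And5 T_gt0 qu_gt0 qu_le qw_gt0 qw_le; rewrite kapE => q0 qD qq.
have N0 : 0 <= qu + 3 * 48%:R^-1 * Dlt by rewrite /Dlt; lra.
have q2 : 2 * q <= 2 * T - qu by lra.
have Ne : qu + 3 * 48%:R^-1 * Dlt <= qu + T / 8%:R by rewrite /Dlt; lra.
case: (leP q (T / 4%:R)) => _.
  have : (qu + 3 * 48%:R^-1 * Dlt) * (T / 4%:R) <= (2 * T) * (T / 4%:R).
    by apply: ler_wpM2r; lra.
  by have := sqr_ge0 T; lra.
have : (qu + 3 * 48%:R^-1 * Dlt) * q <= (qu + T / 8%:R) * (T - qu / 2).
  by apply: ler_pM; lra.
have := sqr_ge0 (qu - T); have : 0 <= T * qu by rewrite mulr_ge0; lra.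
lra.
Qed.

(** For faces with no extremal corner at an extremity. As q1 + q2 <= qu + qw, the sum q1 + q2 is at
    most T. *)
Lemma other_product q1 q2 : 0 <= q1 -> 0 <= q2 -> q1 + q2 + qu + qw <= 2 * T ->
  q1 <= qu -> q1 <= qw -> q2 <= qu -> q2 <= qw ->
  Num.max q1 (T / 4%:R) * Num.max q2 (T / 4%:R) <= T ^+ 2 / 4%:R.
Proof.
have [? ? ? ? ?] := And5 T_gt0 qu_gt0 qu_le qw_gt0 qw_le.
move=> p1 p2 H a b c d; have TT := mulr_gt0 T_gt0 T_gt0.
case: (leP q1 (T / 4%:R)) => l1; case: (leP q2 (T / 4%:R)) => l2.
- lra.
- have : T / 4%:R * q2 <= T / 4%:R * T by apply: ler_wpM2l; lra.
  lra.
- have : q1 * (T / 4%:R) <= T * (T / 4%:R) by apply: ler_wpM2r; lra.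
  lra.
- have := sqr_ge0 (q1 - q2).
  have : (q1 + q2) ^+ 2 <= T ^+ 2 by apply: lerXn2r; rewrite ?nnegrE; lra.
  lra.
Qed.
End Numerics.

(* The weight given below to the corners of boundedly many exceptional faces. *)
Definition label_floor (R : realFieldType) (k : nat) : R :=
  48%:R^-1 / k%:R / 8%:R * (48%:R^-1 / k%:R) / 8%:R.

(** * Construction of the corner weights *)

Section Labelling.
Variables (R : realFieldType) (V C : finType) (D : {set C}) (P : {set {set C}}).
Variables (ver : C -> V) (lat : pred C) (u w : V) (k : nat).
Hypothesis P_part : partition P D.
Hypothesis ver_inj : forall e, e \in P -> {in e &, injective ver}.
Hypothesis card_block : forall e, e \in P -> #|e| = k.
Hypothesis extremal2 : forall e, e \in P -> #|[set c in e | ~~ lat c]| = 2%N.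
Hypothesis lateral2 : forall v, v != u -> v != w ->
  #|[set c in D | (ver c == v) && lat c]| = 2%N.
Hypothesis lateral_extremities : forall c, c \in D -> lat c ->
  ver c != u /\ ver c != w.
Hypothesis uw : u != w.
Notation q := (ext_deg D ver lat).
Hypothesis ext_u : forall v, v != u -> v != w -> (q v <= q u)%N.
Hypothesis ext_w : forall v, v != u -> v != w -> (q v <= q w)%N.
Hypothesis k_ge2 : (2 <= k)%N.

Let T : R := #|P|%:R.
Let Q v : R := (q v)%:R.
Let kap : R := 48%:R^-1.
Let eps : R := kap / k%:R.
Let rho : R := eps / 8%:R.
Let c0 : R := label_floor R k.
Let Dlt := 2 * T - Q u - Q w.
Let N v : R := Q v + 3 * kap * Dlt.

Hypothesis T_large : 1 < label_floor R k ^+ k * #|P|%:R.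

Let big v := [&& v != u, v != w & rho * T < Q v].
Let branching v := [&& v != u, v != w & (0 < q v)%N].
Let spoilt (e : {set C}) := [exists c in e, lat c && big (ver c)].
Let bad (e : {set C}) := [exists c in e, lat c && branching (ver c)].

(* A face is spoilt when it has a lateral corner at a vertex of large extremal
   degree. There are boundedly many such faces, so that all their corners can
   carry the constant weight [c0]. On the other faces, the loss of [1 - eps] at
   the lateral corners of a branching vertex is repaid by [1 + kap] at [u] and
   [w]; over all faces this costs [2 * kap * Dlt] at each of them, less than
   what [N u * N w < T ^+ 2] leaves. *)
Let label c : R :=
  if spoilt (pblock P c) then c0
  else if (ver c == u) || (ver c == w) then
    (if bad (pblock P c) then 1 + kap else 1) / N (ver c)
  else if lat c then (if q (ver c) == 0%N then 2^-1 else (1 - eps) / 2)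
  else if big (ver c) then (1 - eps) / Q (ver c)
  else eps / (2 * Q (ver c)).

Let k_gt0 : 0 < k%:R :> R. Proof. by rewrite ltr0n ltnW. Qed.
Let kap_gt0 : 0 < kap. Proof. by rewrite invr_gt0 ltr0n. Qed.
Let eps_gt0 : 0 < eps. Proof. exact: divr_gt0. Qed.
Let eps_kap : eps <= kap.
Proof. by rewrite ler_pdivrMr // -[leLHS]mulr1 ler_pM2l // ler1n ltnW. Qed.
Let kapE : kap = 48%:R^-1. Proof. by []. Qed.
Let eps_le : eps <= 48%:R^-1. Proof. exact: eps_kap. Qed.
Let rho_gt0 : 0 < rho. Proof. exact: divr_gt0. Qed.
Let c0_gt0 : 0 < c0. Proof. by rewrite divr_gt0 // mulr_gt0. Qed.
Let rhoE : rho = eps / 8%:R. Proof. by []. Qed.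
Let c0E : c0 = rho * eps / 8%:R. Proof. by []. Qed.
Let c0_le : c0 <= 4^-1.
Proof.
have e0 := eps_gt0; have e1 := eps_le; have r0 := rho_gt0.
have h1 : rho * eps <= 1 * 1 by apply: ler_pM; move: r0; rewrite rhoE; lra.
by rewrite c0E; lra.
Qed.

Let P_gt0 : (0 < #|P|)%N.
Proof.
by rewrite lt0n; apply: contraTneq T_large; rewrite /T => ->; rewrite mulr0 ltr10.
Qed.
Let T_gt0 : 0 < T. Proof. by rewrite ltr0n. Qed.

Let Q_ge0 v : 0 <= Q v. Proof. exact: ler0n. Qed.
Let Q_le v : Q v <= T. Proof. by rewrite ler_nat; exact: ext_deg_le. Qed.
Let Qu_gt0 : 0 < Q u.
Proof.
by rewrite ltr0n; have [] :=
  ext_deg_extremity_gt0 P_part ver_inj extremal2 uw ext_u ext_w P_gt0.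
Qed.
Let Qw_gt0 : 0 < Q w.
Proof.
by rewrite ltr0n; have [] :=
  ext_deg_extremity_gt0 P_part ver_inj extremal2 uw ext_u ext_w P_gt0.
Qed.
Let Dlt_ge0 : 0 <= Dlt.
Proof. by have := Q_le u; have := Q_le w; rewrite /Dlt; lra. Qed.

Let N_bounds v : v \in [:: u; w] -> 0 < N v <= 2 * T.
Proof.
move=> vuw; have : Q v + Dlt <= 2 * T /\ 0 < Q v.
  move: vuw; rewrite !inE /Dlt => /orP[]/eqP->; have := Qu_gt0; have := Qw_gt0; lra.
case=> h1 h2; apply/andP; have := Dlt_ge0; have := Q_le v.
by rewrite /N kapE => h3 h4; split; lra.
Qed.

Let n_spoilt := #|[set e in P | spoilt e]|.
Let n_bad := #|[set e in P | bad e]|.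

(** A branching vertex takes at least 1 from the total extremal degree [Dlt] outside [u] and [w],
    and makes at most two faces bad. *)
Let n_bad_le : n_bad%:R <= 2 * Dlt.
Proof.
have S v : branching v -> v != u /\ v != w by case/and3P.
have h1 := lateral_blocks P_part lateral2 S.
have Sm v : branching v -> (1 <= q v)%N by case/and3P.
have h2 := card_other_ext P_part extremal2 uw S Sm.
rewrite mul1n -(ler_nat R) natrM !natrD -/(Q u) -/(Q w) -/T in h2.
rewrite -(ler_nat R) natrM -/n_bad in h1; move: h1 h2; rewrite /Dlt; lra.
Qed.

(** The same count, where a big vertex takes more than [rho * T] from the total [Dlt]. *)
Let n_spoilt_le : n_spoilt%:R * (rho * T) <= 2 * Dlt.
Proof.
have S v : big v -> v != u /\ v != w by case/and3P.
have h1 := lateral_blocks P_part lateral2 S.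
have h2 : #|[set v | big v]|%:R * (rho * T) <= Dlt.
  have := sum_ext_deg_other ver P_part extremal2 uw; move/(congr1 (GRing.natmul (1 : R))).
  rewrite natrM !natrD natr_sum -/(Q u) -/(Q w) -/T => E.
  suff : #|[set v | big v]|%:R * (rho * T) <= \sum_(v | (v != u) && (v != w)) Q v.
    by move: E; rewrite /Dlt /Q; lra.
  rewrite [leRHS](bigID big) /=; rewrite -[leLHS]addr0; apply: lerD; last exact: sumr_ge0.
  rewrite mulr_natl -sumr_const [leRHS](eq_bigl (mem [set v | big v])) => [|v].
    by apply: ler_sum => v; rewrite inE => /and3P[_ _ /ltW].
  rewrite !inE; have [Bv|_] := boolP (big v); last by rewrite andbF.
  by have [-> ->] := S v Bv.
rewrite -(ler_nat R) natrM -/n_spoilt in h1.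
apply: le_trans (_ : (2 * #|[set v | big v]|%:R) * (rho * T) <= _).
  by apply: ler_wpM2r h1; rewrite ltW // mulr_gt0.
by rewrite -mulrA; move: h2; lra.
Qed.

Let n_spoilt_c0 : 4 * T * (n_spoilt%:R * c0) <= eps * Dlt.
Proof.
have := ler_wpM2l (ltW eps_gt0) n_spoilt_le; rewrite c0E; lra.
Qed.

Let n_spoilt_eps : n_spoilt%:R * c0 <= eps / 2.
Proof.
have h : Dlt <= 2 * T by rewrite /Dlt; have := Qu_gt0; have := Qw_gt0; lra.
rewrite -(ler_pM2l (_ : 0 < 4 * T)) ?mulr_gt0 //; apply: le_trans n_spoilt_c0 _.
have := ler_wpM2l (ltW eps_gt0) h; lra.
Qed.

Let at_v v c := (c \in D) && (ver c == v).

Let sum_spoilt v (a : R) : 0 <= a ->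
  \sum_(c | at_v v c) (spoilt (pblock P c))%:R * a <= n_spoilt%:R * a.
Proof.
move=> a0; rewrite -mulr_suml ler_wpM2r // -natr_sum ler_nat.
apply: leq_trans (corners_at_blocks P_part ver_inj v spoilt).
rewrite -sum1_card big_mkcond [leqRHS]big_mkcond /= leq_sum // => c _.
by rewrite inE /at_v; case: (c \in D); case: eqP; case: spoilt.
Qed.

Let sum_bad v (a : R) : 0 <= a ->
  \sum_(c | at_v v c) (bad (pblock P c))%:R * a <= n_bad%:R * a.
Proof.
move=> a0; rewrite -mulr_suml ler_wpM2r // -natr_sum ler_nat.
apply: leq_trans (corners_at_blocks P_part ver_inj v bad).
rewrite -sum1_card big_mkcond [leqRHS]big_mkcond /= leq_sum // => c _.
by rewrite inE /at_v; case: (c \in D); case: eqP; case: bad.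
Qed.

Let sum_ext v (a : R) : \sum_(c | at_v v c) (~~ lat c)%:R * a = Q v * a.
Proof.
rewrite -mulr_suml -natr_sum; congr (_%:R * _).
rewrite /ext_deg -sum1_card big_mkcond [RHS]big_mkcond /=; apply: eq_bigr => c _.
by rewrite inE /at_v; case: (c \in D); case: eqP; case: lat.
Qed.

Let sum_lat v (a : R) : v != u -> v != w -> \sum_(c | at_v v c) (lat c)%:R * a = 2 * a.
Proof.
move=> vu vw; transitivity (#|[set c in D | (ver c == v) && lat c]|%:R * a).
  rewrite -mulr_suml -natr_sum; congr (_%:R * _).
  rewrite -sum1_card big_mkcond [RHS]big_mkcond /=; apply: eq_bigr => c _.
  by rewrite inE /at_v; case: (c \in D); case: eqP; case: lat.
by rewrite lateral2.
Qed.

Let ext_deg_gt0 c : c \in D -> ~~ lat c -> (0 < q (ver c))%N.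
Proof. by move=> cD lc; apply/card_gt0P; exists c; rewrite !inE cD eqxx. Qed.

Let label_gt0 c : c \in D -> 0 < label c.
Proof.
move=> cD; rewrite /label; case: ifP => // _; case: ifP => [cuw|_].
  have /andP[N0 _] : 0 < N (ver c) <= 2 * T by apply: N_bounds; rewrite !inE.
  by rewrite divr_gt0 //; case: ifP => // _; rewrite addr_gt0.
case: ifPn => [_|lc]; first by case: ifP; have := eps_le; lra.
have Q0 : 0 < Q (ver c) by rewrite ltr0n; exact: ext_deg_gt0.
case: ifP => _; last by apply: divr_gt0 => //; exact: mulr_gt0.
by rewrite divr_gt0 //; have := eps_le; lra.
Qed.

(** Multiplied by [N v], the regular part of the weights contributes [Q v], the bad faces add at
    most [2 * kap * Dlt] and the spoilt ones at most [kap * Dlt]; together this is [N v]. *)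
Let label_sum_extremity v : v \in [:: u; w] -> \sum_(c | at_v v c) label c <= 1.
Proof.
move=> vuw; have /andP[N0 N2] := N_bounds vuw.
apply: le_trans (_ : \sum_(c | at_v v c) ((spoilt (pblock P c))%:R * c0 +
   ((~~ lat c)%:R * (N v)^-1 + (bad (pblock P c))%:R * (kap / N v))) <= _).
  apply: ler_sum => c /andP[cD /eqP cv].
  have kN : 0 <= kap / N v by rewrite divr_ge0 ?ltW.
  have iN : 0 <= (N v)^-1 by rewrite invr_ge0 ltW.
  have lc : ~~ lat c.
    apply/negP => lc; have [cu cw] := lateral_extremities cD lc.
    by move: vuw; rewrite -cv !inE (negPf cu) (negPf cw).
  rewrite /label cv; move: vuw; rewrite !inE => ->; rewrite lc /=.
  case: spoilt; case: bad; rewrite ?mul0r ?mul1r ?addr0 ?add0r ?mulrDl ?mul1r //.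
  - by rewrite lerDl addr_ge0.
  - by rewrite lerDl.
rewrite !big_split /= sum_ext.
apply: le_trans (_ : n_spoilt%:R * c0 + (Q v / N v + n_bad%:R * (kap / N v)) <= _).
  apply: lerD; first by apply: sum_spoilt; exact: ltW.
  by rewrite lerD2l; apply: sum_bad; apply: divr_ge0; exact: ltW.
rewrite -(ler_pM2r N0) mul1r mulrDl [X in _ + X]mulrDl -(mulrA _ c0).
rewrite divfK ?gt_eqF // -(mulrA _ (kap / N v)) divfK ?gt_eqF //.
have h1 : n_spoilt%:R * (c0 * N v) <= kap * Dlt.
  have h : n_spoilt%:R * c0 * N v <= n_spoilt%:R * c0 * (2 * T).
    by apply: ler_wpM2l => //; rewrite mulr_ge0 // ltW.
  have h3 : eps * Dlt <= kap * Dlt by apply: ler_wpM2r.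
  have h4 := n_spoilt_c0; have h5 : 0 <= kap * Dlt by rewrite mulr_ge0 // ltW.
  rewrite mulrA; lra.
have h2 : n_bad%:R * kap <= 2 * Dlt * kap by apply: ler_wpM2r => //; exact: ltW.
have NE : N v = Q v + 3 * (kap * Dlt) by rewrite mulrA.
move: h1 h2 NE; rewrite [2 * Dlt * kap]mulrAC -[2 * kap * Dlt]mulrA. lra.
Qed.

(** Without extremal corners, the two lateral ones weigh at most 1/2 each. At a big vertex all
    lateral corners are in spoilt faces, which gives at most eps/2 + (1 - eps). Otherwise the
    lateral, extremal and spoilt shares are at most 1 - eps, eps/2 and eps/2. *)
Let label_sum_other v : v != u -> v != w -> \sum_(c | at_v v c) label c <= 1.
Proof.
move=> vu vw; have e0 := eps_gt0; have e1 := eps_le; have c1 := c0_le.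
have nuw : (v == u) || (v == w) = false by rewrite (negPf vu) (negPf vw).
have [q0|q0] := posnP (q v).
  apply: le_trans (_ : \sum_(c | at_v v c) (lat c)%:R * 2^-1 <= _).
    apply: ler_sum => c /andP[cD /eqP cv].
    have lc : lat c by apply: contraT => /(ext_deg_gt0 cD); rewrite cv q0.
    by rewrite /label cv nuw lc q0 eqxx mul1r; case: ifP => _ //; lra.
  by rewrite sum_lat // divff // pnatr_eq0.
have Q0 : 0 < Q v by rewrite ltr0n.
have qn0 : (q v == 0)%N = false by rewrite eqn0Ngt q0.
have [bv|sv] := boolP (big v).
  apply: le_trans (_ : \sum_(c | at_v v c) ((spoilt (pblock P c))%:R * c0 +
     (~~ lat c)%:R * ((1 - eps) / Q v)) <= _).
    apply: ler_sum => c /andP[cD /eqP cv]; have [pP cp] := corner_block P_part cD.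
    have p0 : 0 <= (1 - eps) / Q v by rewrite divr_ge0 //; lra.
    rewrite /label cv nuw qn0 bv; case: ifPn => [_|nE].
      by rewrite mul1r lerDl mulr_ge0.
    rewrite mul0r add0r; case: ifPn => [lc|lc]; last by rewrite mul1r.
    case/negP: nE; apply/exists_inP; exists c => //; by rewrite lc cv.
  rewrite big_split /= sum_ext mulrC divfK ?gt_eqF //.
  have := sum_spoilt v (ltW c0_gt0); have := n_spoilt_eps; lra.
apply: le_trans (_ : \sum_(c | at_v v c) ((spoilt (pblock P c))%:R * c0 +
     ((lat c)%:R * ((1 - eps) / 2) + (~~ lat c)%:R * (eps / (2 * Q v)))) <= _).
  apply: ler_sum => c /andP[cD /eqP cv].
  have p0 : 0 <= eps / (2 * Q v) by apply/ltW/divr_gt0 => //; exact: mulr_gt0.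
  rewrite /label cv nuw qn0 (negPf sv); case: ifPn => [_|nE].
    rewrite mul1r lerDl; apply: addr_ge0; last exact: mulr_ge0.
    by apply: mulr_ge0 => //; lra.
  by rewrite mul0r add0r; case: (lat c); rewrite ?mul0r ?mul1r ?addr0 ?add0r.
rewrite !big_split /= sum_ext sum_lat //.
have -> : Q v * (eps / (2 * Q v)) = eps / 2 by field; rewrite gt_eqF.
have := sum_spoilt v (ltW c0_gt0); have := n_spoilt_eps; lra.
Qed.

Lemma labelling_sum v : \sum_(c | (c \in D) && (ver c == v)) label c <= 1.
Proof.
have [vuw|] := boolP (v \in [:: u; w]); first exact: label_sum_extremity.
by rewrite !inE => /norP[vu vw]; exact: label_sum_other.
Qed.

Let M v := Num.max (Q v) (T / 4).

Let M_gt0 v : 0 < M v. Proof. by rewrite lt_max [X in _ || X]divr_gt0 ?orbT. Qed.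

Let label_extremity c : ~~ spoilt (pblock P c) -> ver c \in [:: u; w] ->
  label c = (if bad (pblock P c) then 1 + kap else 1) / N (ver c).
Proof. by rewrite /label !inE => /negPf-> ->. Qed.

(** A vertex that is not big gives at least 4/T; this is what the floor T/4 in [M] records. *)
Let label_other c : c \in D -> ~~ lat c -> ~~ spoilt (pblock P c) ->
  ver c \notin [:: u; w] -> (1 - eps) / M (ver c) <= label c.
Proof.
move=> cD lc nE cuw; have e1 := eps_le; have e0 := eps_gt0.
have Q0 : 0 < Q (ver c) by rewrite ltr0n; exact: ext_deg_gt0.
have nuw : (ver c == u) || (ver c == w) = false by move: cuw; rewrite !inE => /negPf.
rewrite /label (negPf nE) nuw (negPf lc); case: ifPn => [_|].
  apply: ler_wpM2l; first lra.
  by rewrite lef_pV2 ?posrE // le_max lexx.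
rewrite /big; case/norP: (negbT nuw) => -> -> /=; rewrite -leNgt => Qs.
apply: le_trans (_ : 4 / T <= _).
  rewrite ler_pdivrMr // -ler_pdivrMl ?divr_gt0 // invf_div.
  apply: le_trans (_ : T / 4 <= _); last by rewrite le_max lexx orbT.
  by rewrite mulrC ler_piMl //; [exact: divr_ge0|lra].
rewrite ler_pdivlMr ?mulr_gt0 // mulrAC ler_pdivrMr //.
by move: Qs; rewrite rhoE; lra.
Qed.

(** In a face that is not bad, all lateral corners weigh exactly 1/2. In a bad one, Bernoulli's
    inequality bounds the loss by k eps = kap. *)
Let prod_lateral e : e \in P -> ~~ spoilt e ->
  (if bad e then 1 - kap else 1) <= 2 ^+ (k - 2) * \prod_(c in e | lat c) label c.
Proof.
move=> eP nE; have e1 := eps_le; have e0 := eps_gt0.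
have cE : #|[set c in e | lat c]| = (k - 2)%N.
  have := cardsID [set c | lat c] e; rewrite (card_block eP) => <-.
  rewrite (_ : #|e :\: _| = 2%N) ?addnK //; last first.
    by rewrite -(extremal2 eP); apply: eq_card => c; rewrite !inE andbC.
  by apply: eq_card => c; rewrite !inE.
have lE c : c \in e -> lat c ->
    label c = if q (ver c) == 0%N then 2^-1 else (1 - eps) / 2.
  move=> ce lc; have [cD pc] := block_corner P_part eP ce.
  have [cu cw] := lateral_extremities cD lc.
  by rewrite /label pc (negPf nE) (negPf cu) (negPf cw) lc.
have prodE (a : R) : 2 ^+ (k - 2) * \prod_(c in e | lat c) (a / 2) = a ^+ (k - 2).
  rewrite (eq_bigl (fun c => c \in [set c in e | lat c])) => [|c]; last by rewrite !inE.
  by rewrite prodr_const cE -exprMn mulrC divfK // pnatr_eq0.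
case: ifPn => [_|nb].
  apply: le_trans (_ : (1 - eps) ^+ (k - 2) <= _).
    apply: le_trans (bernoulli_le (x := eps) (k - 2) _); last by apply/andP; split; lra.
    rewrite lerD2l lerN2; apply: le_trans (_ : k%:R * eps <= _).
      by apply: ler_wpM2r; rewrite ?ler_nat ?leq_subr // ltW.
    by rewrite mulrC divfK // gt_eqF.
  rewrite -(prodE (1 - eps)); apply: ler_wpM2l; first by rewrite exprn_ge0.
  apply: ler_prod => c /andP[ce lc]; rewrite lE //; apply/andP; split; first lra.
  by case: ifP => _; lra.
apply: le_trans (_ : 2 ^+ (k - 2) * \prod_(c in e | lat c) (1 / 2) <= _).
  by rewrite prodE expr1n.
apply: ler_wpM2l; first by rewrite exprn_ge0.
rewrite le_eqVlt; apply/orP; left; apply/eqP; apply: eq_bigr => c /andP[ce lc].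
rewrite lE // mul1r; case: eqP => // /eqP; rewrite -lt0n => q0.
have [cD pc] := block_corner P_part eP ce.
have [cu cw] := lateral_extremities cD lc.
case/negP: nb; apply/exists_inP; exists c => //; by rewrite lc /branching cu cw.
Qed.

Let prod_split e : e \in P -> exists c d, [/\ c \in e, d \in e, ~~ lat c, ~~ lat d & c != d] /\
  \prod_(c in e) label c = label c * label d * \prod_(c in e | lat c) label c.
Proof.
move=> eP; have /eqP/cards2P[c [d [cd E]]] := extremal2 eP.
have : c \in [set c in e | ~~ lat c] by rewrite E !inE eqxx.
have : d \in [set c in e | ~~ lat c] by rewrite E !inE eqxx orbT.
rewrite !inE => /andP[de ld] /andP[ce lc]; exists c, d; split=> //.
rewrite (bigID lat) /= mulrC; congr (_ * _).
rewrite (eq_bigl (mem [set c; d])) => [|x]; last by rewrite -E !inE.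
by rewrite big_setU1 ?inE //= big_set1.
Qed.

(** In a bad face the gains at [u] and [w] repay the lateral loss: (1 - kap)(1 + kap)^2 >= 1. What
    remains is T^2 / (N u * N w). *)
Let prod_extremities (b : bool) (x y : R) :
  x = (if b then 1 + kap else 1) / N u -> y = (if b then 1 + kap else 1) / N w ->
  1 <= (if b then 1 - kap else 1) * T ^+ 2 * (x * y) /\
  (0 < Dlt -> 1 < (if b then 1 - kap else 1) * T ^+ 2 * (x * y)).
Proof.
move=> -> ->; have /andP[Nu0 _] : 0 < N u <= 2 * T by apply: N_bounds; rewrite inE eqxx.
have /andP[Nw0 _] : 0 < N w <= 2 * T by apply: N_bounds; rewrite !inE eqxx orbT.
have NN : 0 < N u * N w by exact: mulr_gt0.
set a := if b then 1 + kap else 1; set l := if b then 1 - kap else 1.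
have al : 1 <= l * a ^+ 2 by rewrite /l /a; case: (b); rewrite ?kapE; lra.
have -> : l * T ^+ 2 * (a / N u * (a / N w)) = l * a ^+ 2 * (T ^+ 2 / (N u * N w)).
  by field; rewrite !gt_eqF.
have TT : 0 < T ^+ 2 by exact: exprn_gt0.
have tr x' : 0 < x' -> x' <= l * a ^+ 2 * x' by move=> x0; rewrite ler_peMl // ltW.
have pos : 0 < T ^+ 2 / (N u * N w) by exact: divr_gt0.
split=> [|D0]; last first.
  apply: lt_le_trans (tr _ pos); rewrite ltr_pdivlMr // mul1r.
  exact: extremity_product D0.
apply: le_trans (tr _ pos); rewrite ler_pdivlMr // mul1r.
have [D0|D0] := ltP 0 Dlt; first by apply/ltW/extremity_product.
have {}D0 : Dlt = 0 by apply/le_anti; rewrite D0 Dlt_ge0.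
rewrite /N D0 mulr0 !addr0 expr2; apply: ler_pM;
  [exact: ltW Qu_gt0|exact: ltW Qw_gt0|exact: Q_le|exact: Q_le].
Qed.

Let label_ge_extremity c v : ~~ spoilt (pblock P c) -> ver c = v -> v \in [:: u; w] ->
  (N v)^-1 <= label c.
Proof.
move=> nE <- cuw; rewrite label_extremity //.
have /andP[N0 _] := N_bounds cuw.
rewrite -[leLHS]mul1r; apply: ler_wpM2r; first by rewrite invr_ge0 ltW.
by case: ifP => // _; rewrite lerDl ltW.
Qed.

(** The two losses leave at least (47/48)^2, well above 5/8. *)
Let final_bound (l x y m1 m2 a : R) : 1 - kap <= l -> 0 < m1 -> 0 < m2 ->
  1 - kap <= a -> a / m1 * m2^-1 <= x * y ->
  m1 * m2 <= 5 / 8 * T ^+ 2 -> 1 < l * T ^+ 2 * (x * y).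
Proof.
rewrite kapE => l1 p1 p2 a1 xy mm; have TT : 0 < T ^+ 2 by exact: exprn_gt0.
apply: lt_le_trans (ler_wpM2l _ xy); last by rewrite mulr_ge0 ?ltW //; lra.
have -> : l * T ^+ 2 * (a / m1 / m2) = (l * a) * T ^+ 2 / (m1 * m2).
  by field; rewrite !gt_eqF.
rewrite ltr_pdivlMr ?mulr_gt0 // mul1r; apply: le_lt_trans mm _.
rewrite ltr_pM2r //; apply: lt_le_trans (_ : (47 / 48) * (47 / 48) <= _); first lra.
by apply: ler_pM; lra.
Qed.

Let QE v : Q v = (q v)%:R. Proof. by []. Qed.

(** Spoilt faces apart, the cases are the number of extremal corners at [u] or [w]. The strict bound
    is missed only if both are there and [Dlt] is 0. *)
Lemma labelling_prod e : e \in P ->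
  1 <= 2 ^+ (k - 2) * T ^+ 2 * \prod_(c in e) label c /\
  (0 < Dlt -> 1 < 2 ^+ (k - 2) * T ^+ 2 * \prod_(c in e) label c).
Proof.
move=> eP; have e1 := eps_le; have e0 := eps_gt0.
suff [lt1|[E le1]] : 1 < 2 ^+ (k - 2) * T ^+ 2 * \prod_(c in e) label c \/
   (Dlt <= 0 /\ 1 <= 2 ^+ (k - 2) * T ^+ 2 * \prod_(c in e) label c).
- by split=> //; exact: ltW.
- by split=> //; rewrite ltNge E.
have [Ee|nE] := boolP (spoilt e).
  (* One factor T times c0^k exceeds 1 by [T_large]; the other factors are at least 1. *)
  left; rewrite (eq_bigr (fun=> c0)) => [|c ce]; last first.
    by have [_ pc] := block_corner P_part eP ce; rewrite /label pc Ee.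
  rewrite prodr_const card_block //.
  have -> : 2 ^+ (k - 2) * T ^+ 2 * c0 ^+ k = (2 ^+ (k - 2) * T) * (c0 ^+ k * T) by ring.
  apply: lt_le_trans T_large _; apply: ler_peMl.
    by rewrite mulr_ge0 ?exprn_ge0 // ltW.
  by apply: mulr_ege1; [apply: exprn_ege1; lra|rewrite ler1n].
have [c [d [[ce de lc ld cd] ->]]] := prod_split eP.
have [cD pc] := block_corner P_part eP ce; have [dD pd] := block_corner P_part eP de.
have vcd : ver c != ver d by apply: contra cd => /eqP/(ver_inj eP ce de)->.
have lat_ge := prod_lateral eP nE.
set L := \prod_(_ in e | _) _ in lat_ge *.
have lc0 := label_gt0 cD; have ld0 := label_gt0 dD.
have TT : 0 < T ^+ 2 by exact: exprn_gt0.
have -> : 2 ^+ (k - 2) * T ^+ 2 * (label c * label d * L) =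
  (2 ^+ (k - 2) * L) * T ^+ 2 * (label c * label d) by ring.
set l := if bad e then _ else _ in lat_ge.
have l1 : 1 - kap <= l by rewrite /l; case: ifP => // _; rewrite kapE; lra.
suff [lt1|[E le1]] : 1 < l * T ^+ 2 * (label c * label d) \/
   (Dlt <= 0 /\ 1 <= l * T ^+ 2 * (label c * label d)).
- left; apply: lt_le_trans lt1 _; apply: ler_wpM2r; first by rewrite mulr_ge0 ?ltW.
  by rewrite ler_pM2r.
- right; split=> //; apply: le_trans le1 _; apply: ler_wpM2r; first by rewrite mulr_ge0 ?ltW.
  by rewrite ler_pM2r.
have nEc : ~~ spoilt (pblock P c) by rewrite pc.
have nEd : ~~ spoilt (pblock P d) by rewrite pd.
have uin : u \in [:: u; w] by rewrite inE eqxx.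
have win : w \in [:: u; w] by rewrite !inE eqxx orbT.
(* After a possible exchange, the first corner is at an extremity as soon as either is. *)
wlog : c d ce de lc ld cd cD pc dD pd vcd lc0 ld0 nEc nEd /
    (ver c \notin [:: u; w]) ==> (ver d \notin [:: u; w]).
  move=> W; case cuw: (ver c \in [:: u; w]); last first.
    case duw: (ver d \in [:: u; w]); last by apply: W => //; rewrite cuw duw.
    rewrite [label c * _]mulrC; apply: W => //; first by rewrite eq_sym.
      by rewrite eq_sym.
    by rewrite duw.
  by apply: W => //; rewrite cuw.
have [cuw _|cuw /= duw] := boolP (ver c \in [:: u; w]).
  have [duw|duw] := boolP (ver d \in [:: u; w]).
    have H : 1 <= l * T ^+ 2 * (label c * label d) /\
        (0 < Dlt -> 1 < l * T ^+ 2 * (label c * label d)).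
      have Lc := label_extremity nEc cuw; have Ld := label_extremity nEd duw.
      rewrite pc in Lc; rewrite pd in Ld.
      move: vcd Lc Ld cuw duw; rewrite !inE => vcd Lc Ld /orP[]/eqP cE /orP[]/eqP dE.
      - by rewrite cE dE eqxx in vcd.
      - by apply: prod_extremities; rewrite ?Lc ?Ld ?cE ?dE.
      - by rewrite [label c * _]mulrC; apply: prod_extremities; rewrite ?Lc ?Ld ?cE ?dE.
      - by rewrite cE dE eqxx in vcd.
    by have [D0|D0] := ltP 0 Dlt; [left; apply: H.2|right; split=> //; exact: H.1].
  left; have Nc := N_bounds cuw; case/andP: Nc => Nc0 _.
  apply: (final_bound (m1 := M (ver d)) (m2 := N (ver c)) (a := 1 - eps)) => //.
  - by rewrite lerD2l lerN2.
  - rewrite [label c * _]mulrC; apply: ler_pM.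
    + by rewrite divr_ge0 ?ltW //; lra.
    + by rewrite invr_ge0 ltW.
    + exact: label_other.
    + exact: label_ge_extremity.
  - move: duw; rewrite !inE negb_or => /andP[du dw].
    have h1 := ext_deg_other ver P_part extremal2 uw du dw.
    rewrite -(ler_nat R) natrM !natrD -!QE -/T in h1.
    have h2 := ext_u du dw; have h3 := ext_w du dw.
    rewrite -(ler_nat R) -!QE in h2; rewrite -(ler_nat R) -!QE in h3.
    rewrite mulrC; move: cuw; rewrite !inE => /orP[]/eqP ->.
      by apply: (extremity_other_product (qw := Q w)).
    rewrite /N /Dlt (addrAC _ (- Q u)).
    apply: (extremity_other_product (qu := Q w) (qw := Q u)) => //.
    by rewrite addrAC.
left; apply: (final_bound (m1 := M (ver c)) (m2 := M (ver d)) (a := (1 - eps) * (1 - eps))) => //.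
(* Then (1 - eps)^2 >= 1 - 2 eps >= 1 - kap. *)
- have eps2 : 2 * eps <= kap.
    rewrite -[kap](divfK (_ : k%:R != 0)) ?gt_eqF // -/eps mulrC.
    by apply: ler_wpM2l; [exact: ltW|rewrite ler_nat].
  by have := sqr_ge0 eps; lra.
- have -> : (1 - eps) * (1 - eps) / M (ver c) / M (ver d) =
    ((1 - eps) / M (ver c)) * ((1 - eps) / M (ver d)) by field; rewrite !gt_eqF.
  have p v : 0 <= (1 - eps) / M v by rewrite divr_ge0 ?ltW //; lra.
  by apply: ler_pM => //; exact: label_other.
- move: cuw duw; rewrite !inE !negb_or => /andP[cu cw] /andP[du dw].
  have h1 := ext_deg_other2 ver P_part extremal2 uw cu cw du dw vcd.
  rewrite -(ler_nat R) natrM !natrD -!QE -/T in h1.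
  have h2 := ext_u du dw; have h3 := ext_w du dw.
  have h4 := ext_u cu cw; have h5 := ext_w cu cw.
  rewrite -(ler_nat R) -!QE in h2; rewrite -(ler_nat R) -!QE in h3.
  rewrite -(ler_nat R) -!QE in h4; rewrite -(ler_nat R) -!QE in h5.
  apply: le_trans (other_product (qu := Q u) (qw := Q w) _ _ _ _ _ _ _ _ _ _ _ _) _ => //.
  by rewrite -[T ^+ 2 / 4]mulrC; apply: ler_wpM2r; [exact: ltW|lra].
Qed.

Lemma labelling : exists B : C -> R,
  [/\ forall c, c \in D -> 0 < B c,
      forall v, \sum_(c | (c \in D) && (ver c == v)) B c <= 1,
      forall e, e \in P -> 1 <= 2 ^+ (k - 2) * #|P|%:R ^+ 2 * \prod_(c in e) B c &
      (q u + q w < 2 * #|P|)%N -> forall e, e \in P ->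
        1 < 2 ^+ (k - 2) * #|P|%:R ^+ 2 * \prod_(c in e) B c].
Proof.
exists label; split=> //.
- exact: labelling_sum.
- by move=> e /labelling_prod[].
- move=> qD e /labelling_prod[_]; apply.
  by rewrite -(ltr_nat R) natrD natrM in qD; rewrite /Dlt /Q /T; lra.
Qed.

End Labelling.

(** * Spectral radius *)

Section LabelBound.
Variables (R : realFieldType) (V C : finType) (D : {set C}) (P : {set {set C}}).
Variables (ver : C -> V) (k : nat) (B : C -> R) (r : R).
Hypothesis P_part : partition P D.
Hypothesis ver_inj : forall e, e \in P -> {in e &, injective ver}.
Hypothesis card_block : forall e, e \in P -> #|e| = k.
Hypothesis k_gt0 : (0 < k)%N.
Hypothesis r_gt0 : 0 < r.
Hypothesis B_gt0 : forall c, c \in D -> 0 < B c.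
Hypothesis B_sum : forall v, \sum_(c | (c \in D) && (ver c == v)) B c <= 1.
Variable x : V -> R.
Hypothesis x_ge0 : forall v, 0 <= x v.
Hypothesis x_sum : \sum_v x v ^+ k = 1.

Let S (e : {set C}) := \sum_(c in e) B c * x (ver c) ^+ k.

Let blockD e c : e \in P -> c \in e -> c \in D.
Proof. by case/and3P: P_part => /eqP <- _ _ eP ce; apply/bigcupP; exists e. Qed.

Let S_ge0 e : e \in P -> 0 <= S e.
Proof.
move=> eP; apply: sumr_ge0 => c ce.
by rewrite mulr_ge0 ?exprn_ge0 // ltW // B_gt0 // (blockD eP).
Qed.

Let S_sum : \sum_(e in P) S e <= 1.
Proof.
have /and3P[/eqP cov tP _] := P_part.
have <- : \sum_(c in D) B c * x (ver c) ^+ k = \sum_(e in P) S e.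
  by rewrite -cov finset.big_trivIset.
rewrite (partition_big ver predT) //= -x_sum.
apply: ler_sum => v _; rewrite (eq_bigr (fun c => B c * x v ^+ k)); last first.
  by move=> c /andP[_ /eqP->].
by rewrite -mulr_suml -[leRHS]mul1r ler_wpM2r ?exprn_ge0.
Qed.

(** AM-GM for the k terms [B c * x (ver c) ^+ k] of a face, in k-th powers to avoid roots. *)
Let agm e : e \in P ->
  (k%:R * \prod_(c in e) x (ver c)) ^+ k * (r ^+ k * \prod_(c in e) B c) <= (r * S e) ^+ k.
Proof.
move=> eP; have := leif_AGM (A := mem e) (E := fun c => B c * x (ver c) ^+ k).
case=> [c ce|]; first by rewrite mulr_ge0 ?exprn_ge0 // ltW // B_gt0 // (blockD eP).
rewrite -/(S e) big_split /= prodrXl card_block // => H _.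
rewrite !exprMn; move: H; rewrite expr_div_n.
have kk : 0 < k%:R ^+ k :> R by rewrite exprn_gt0 // ltr0n.
rewrite ler_pdivlMr // => H.
have -> : forall a b c d : R, a * b * (c * d) = c * (d * b * a) by move=> *; ring.
by apply: ler_wpM2l => //; rewrite exprn_ge0 // ltW.
Qed.

Let pr_ge0 (e : {set C}) : 0 <= k%:R * \prod_(c in e) x (ver c).
Proof. by rewrite mulr_ge0 ?prodr_ge0. Qed.

Let term_le e : e \in P -> 1 <= r ^+ k * \prod_(c in e) B c ->
  k%:R * \prod_(c in e) x (ver c) <= r * S e.
Proof.
move=> eP h; have rS : 0 <= r * S e by apply: mulr_ge0 (ltW r_gt0) (S_ge0 eP).
rewrite -(ler_pXn2r k_gt0) ?nnegrE ?pr_ge0 //.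
by apply: le_trans (agm eP); rewrite ler_peMr // exprn_ge0.
Qed.

Let term_lt e : e \in P -> 1 < r ^+ k * \prod_(c in e) B c -> 0 < S e ->
  k%:R * \prod_(c in e) x (ver c) < r * S e.
Proof.
move=> eP h S0; have rS : 0 < r * S e by exact: mulr_gt0.
have [->//|p0] := eqVneq (k%:R * \prod_(c in e) x (ver c)) 0.
have {}p0 : 0 < k%:R * \prod_(c in e) x (ver c) by rewrite lt_neqAle eq_sym p0 pr_ge0.
rewrite -(ltr_pXn2r k_gt0) ?nnegrE ?pr_ge0 ?(ltW rS) //.
apply: lt_le_trans (agm eP); rewrite ltr_pMr //; exact: exprn_gt0.
Qed.

Lemma corner_form_le : (forall e, e \in P -> 1 <= r ^+ k * \prod_(c in e) B c) ->
  k%:R * \sum_(e in P) \prod_(c in e) x (ver c) <= r.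
Proof.
move=> h; rewrite mulr_sumr; apply: le_trans (_ : \sum_(e in P) r * S e <= _).
  by apply: ler_sum => e eP; apply: term_le => //; exact: h.
by rewrite -mulr_sumr -[leRHS]mulr1 ler_wpM2l // ltW.
Qed.

Lemma corner_form_lt : (forall e, e \in P -> 1 < r ^+ k * \prod_(c in e) B c) ->
  k%:R * \sum_(e in P) \prod_(c in e) x (ver c) < r.
Proof.
move=> h; rewrite mulr_sumr.
have tl e : e \in P -> k%:R * \prod_(c in e) x (ver c) <= r * S e.
  by move=> eP; apply: term_le => //; exact: ltW (h e eP).
(* One face with positive [S e] makes the sum strict; if there is none, all products vanish and the
   form is 0. *)
have [e0 /andP[e0P S0]|all0] := pickP [pred e | (e \in P) && (0 < S e)]; last first.
  rewrite big1 // => e eP; apply/le_anti; rewrite pr_ge0 andbT.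
  have := tl e eP; have := all0 e; rewrite /= eP /= => /negbT; rewrite -leNgt => S0.
  by move/le_trans; apply; rewrite pmulr_rle0.
apply: lt_le_trans (_ : \sum_(e in P) r * S e <= _).
  rewrite (bigD1 e0) //= [ltRHS](bigD1 e0) //=; apply: ltr_leD.
    by apply: term_lt => //; exact: h.
  by apply: ler_sum => e /andP[eP _]; exact: tl.
by rewrite -mulr_sumr -[leRHS]mulr1 ler_wpM2l // ltW.
Qed.

End LabelBound.

Section Radius.
Variables (R : realType) (V : finType) (k : nat).

(** Only an inequality: faces with equal vertex sets give one hyperedge, but each counts on the
    right. *)
Lemma hypergraph_form_imset_le (C : finType) (P : {set {set C}}) (ver : C -> V)
    (x : V -> R) : (forall e, e \in P -> {in e &, injective ver}) ->
  (forall v, 0 <= x v) ->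
  hypergraph_form k [set ver @: (e : {set C}) | e in P] x <=
  k%:R * \sum_(e in P) \prod_(c in e) x (ver c).
Proof.
move=> ver_inj x_ge0; rewrite /hypergraph_form ler_wpM2l //.
rewrite [leRHS](partition_big_imset (fun e : {set C} => ver @: e)) /=.
apply: ler_sum => h /imsetP[e eP ->]; rewrite (bigD1 e) /= ?eP ?eqxx //.
rewrite big_imset /=; last exact: ver_inj.
by rewrite lerDl; apply: sumr_ge0 => *; exact: prodr_ge0.
Qed.

Definition theta_radius (t : nat) : R := (2 ^+ (k - 2) * t%:R ^+ 2) `^ k%:R^-1.

Lemma theta_radius_gt0 t : (0 < t)%N -> 0 < theta_radius t.
Proof. by move=> t0; rewrite powR_gt0 // mulr_gt0 ?exprn_gt0 // ltr0n. Qed.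

Lemma theta_radiusX t : (0 < k)%N -> theta_radius t ^+ k = 2 ^+ (k - 2) * t%:R ^+ 2.
Proof.
move=> k0; rewrite -powR_mulrn ?powR_ge0 // -powRrM mulVf ?pnatr_eq0 -?lt0n //.
by rewrite powRr1 // mulr_ge0 ?exprn_ge0.
Qed.

Hypothesis k_gt0 : (0 < k)%N.

(** The test vector is the equality case of AM-GM: with corner weights 1/t at [u] and [w] and 1/2
    elsewhere, every corner contributes 1/(kt). *)
Lemma theta_radius_lower (H : {set {set V}}) (u w : V) : u != w -> (2 < #|V|)%N ->
  (forall e, e \in H -> [/\ #|e| = k, u \in e & w \in e]) ->
  ((k - 2) * #|H| = 2 * (#|V| - 2))%N ->
  theta_radius #|H| <= spectral_radius R k H.
Proof.
move=> uw V2 He count; set t := #|H|.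
have k2 : (2 < k)%N by rewrite -subn_gt0 lt0n; apply/eqP=> k0; rewrite k0 in count; lia.
have t0 : (0 < t)%N by rewrite lt0n; apply/eqP => t0; rewrite -/t t0 in count; lia.
have k0 : k%:R != 0 :> R by rewrite pnatr_eq0 -lt0n.
have tn0 : t%:R != 0 :> R by rewrite pnatr_eq0 -lt0n.
pose a : R := k%:R^-1 `^ k%:R^-1; pose b : R := (2 / (k%:R * t%:R)) `^ k%:R^-1.
have aX : a ^+ k = k%:R^-1.
  by rewrite -powR_mulrn ?powR_ge0 // -powRrM mulVf // powRr1 ?invr_ge0.
have bX : b ^+ k = 2 / (k%:R * t%:R).
  by rewrite -powR_mulrn ?powR_ge0 // -powRrM mulVf // powRr1 ?divr_ge0 ?mulr_ge0.
pose x v := if (v == u) || (v == w) then a else b.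
have x0 v : 0 <= x v by rewrite /x; case: ifP => _; exact: powR_ge0.
have xW : unit_weights k x.
  split=> //; rewrite (bigD1 u) //= (bigD1 w) 1?eq_sym //= /x !eqxx orbT /= aX.
  rewrite (eq_bigr (fun=> b ^+ k)) => [|v /andP[/negPf-> /negPf->] //].
  rewrite sumr_const bX (eq_card (B := ~: [set u; w])) => [|v]; last by rewrite !inE negb_or.
  have := cardsC [set u; w]; rewrite cards2 uw /= => cc.
  have -> : #|~: [set u; w]| = (#|V| - 2)%N by rewrite -cc addKn.
  have c2 : (k%:R - 2) * t%:R = 2 * (#|V| - 2)%N%:R :> R.
    by rewrite -natrB ?(ltnW k2) // -!natrM count.
  rewrite -[_ / _ *+ _]mulr_natr mulrAC -c2; by field; rewrite k0 tn0.
have formE : hypergraph_form k H x = k%:R * (t%:R * (a ^+ 2 * b ^+ (k - 2))).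
  rewrite /hypergraph_form (eq_bigr (fun=> a ^+ 2 * b ^+ (k - 2))) => [|e eH].
    by rewrite sumr_const -[X in _ * X]mulr_natl.
  have [ce ue we] := He e eH.
  rewrite (bigD1 u) //= (bigD1 w) ?we 1?eq_sym //= mulrA {1 2}/x !eqxx orbT /= -expr2.
  congr (_ * _); rewrite (eq_bigr (fun=> b)); last first.
    by move=> v /andP[/andP[_ /negPf vu] /negPf vw]; rewrite /x vu vw.
  rewrite (eq_bigl (fun v => v \in e :\: [set u; w])) => [|v]; last first.
    by rewrite !inE negb_or; case: (v \in e); rewrite ?andbF ?andbT.
  rewrite prodr_const; congr (_ ^+ _); rewrite -ce -(cardsID [set u; w] e).
  rewrite (setIidPr _) ?cards2 ?uw ?addKn //.
  by apply/subsetP=> v; rewrite !inE => /orP[]/eqP->.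
have radE : theta_radius t = hypergraph_form k H x.
  apply/eqP; rewrite -(eqrXn2 k_gt0) ?powR_ge0 //; last first.
    by rewrite formE !mulr_ge0 ?exprn_ge0 ?powR_ge0.
  rewrite theta_radiusX // formE !exprMn -!exprM ![(_ * k)%N]mulnC !exprM aX bX.
  have kE (y : R) : y ^+ k = y ^+ (k - 2) * y ^+ 2 by rewrite -exprD subnK // ltnW.
  rewrite (kE k%:R) (kE t%:R); apply/eqP; rewrite expr_div_n exprMn.
  have Km : k%:R ^+ (k - 2) != 0 :> R by rewrite expf_neq0.
  have tm : t%:R ^+ (k - 2) != 0 :> R by rewrite expf_neq0.
  move: Km tm; set x1 := k%:R ^+ _; set x2 := t%:R ^+ _; set x3 := 2 ^+ _ => Km tm.
  by field; rewrite k0 Km tm.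
rewrite radE; have [y [yW <-]] := spectral_radius_max R H k_gt0 (ltnW (ltnW V2)).
exact.
Qed.
End Radius.

(** * Upper bound for closed angulations, with its equality case *)

Section AngulationRadius.
Variables (R : realType) (V : finType) (G : embedding V) (k : nat).
Hypothesis G_ang : closed_angulation G k.
Hypothesis k_gt2 : (2 < k)%N.
Hypothesis t_large : 1 < label_floor R k ^+ k * #|faces G|%:R.

Let GS := angulation_simple G_ang.
Let GR := angulation_rot G_ang.
Let adj_sym : symmetric (adj G). Proof. by case: GS. Qed.
Notation t := #|faces G|.

Lemma card_in_darts v : #|[set e in darts G | e.2 == v]| = #|nbrs G v|.
Proof.
rewrite -(card_imset (mem (nbrs G v)) (_ : injective (fun z => (z, v)))); last by move=> x y [].
apply: eq_card => -[x y]; rewrite !inE /=; apply/andP/imsetP.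
  by case=> xy /eqP yv; exists x; rewrite ?yv // inE adj_sym -yv.
by case=> z; rewrite inE => vz [-> ->]; rewrite adj_sym.
Qed.

(** The vertices [u] and [w] have the two largest degrees. They have no lateral corner and all
    others have two, so their extremal degrees are the largest as well, as the weights require. *)
Lemma angulation_radius :
  [/\ spectral_radius R k (face_hypergraph G) <= theta_radius R k t &
   spectral_radius R k (face_hypergraph G) < theta_radius R k t \/
   exists u w, [/\ u != w, forall F, F \in faces G ->
     u \in face_vertices F /\ w \in face_vertices F &
     forall v, v != u -> v != w -> #|nbrs G v| = 2%N]].
Proof.
have V2 : (2 < #|V|)%N by case: G_ang => _ [].
have [v0 _] : exists v0 : V, v0 \in V by apply/card_gt0P; exact: ltnW (ltnW V2).
pose deg v := #|[set e in darts G | e.2 == v]|.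
case: (arg_maxnP deg (erefl (predT v0))) => u _ umax.
have [v1 v1u] : exists v1, v1 != u.
  apply/existsP; rewrite -[[exists _, _]]negbK negb_exists; apply/negP => /forallP allu.
  have : (#|V| <= #|[set u]|)%N.
    by apply/subset_leq_card/subsetP => v _; have := allu v; rewrite negbK inE.
  by rewrite cards1; lia.
have [w wu wmax] := arg_maxnP (P := fun v => v != u) deg v1u.
have uw : u != w by rewrite eq_sym.
have [h [h_inj h_min h_max h_mid]] := angulation_st_numbering G_ang uw.
have [lat2 ext2] := lateral_extremal_count G_ang uw h_inj h_mid.
set lat := lateral G h in lat2 ext2.
have uin : u \in [:: u; w] by rewrite inE eqxx.
have win : w \in [:: u; w] by rewrite !inE eqxx orbT.
have latext c : c \in darts G -> lat c -> c.2 != u /\ c.2 != w.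
  move=> cD lc; split; apply/eqP => cE.
    by have := lateral_extremity G_ang h_min h_max uin cD cE; rewrite -/lat lc.
  by have := lateral_extremity G_ang h_min h_max win cD cE; rewrite -/lat lc.
pose q := ext_deg (darts G) snd lat.
have qE v : v != u -> v != w -> deg v = (q v + 2)%N.
  move=> vu vw; rewrite -(lat2 v vu vw) addnC /deg /q /ext_deg.
  rewrite -(cardsID [set e | lat e]); congr (_ + _)%N; apply: eq_card => e; rewrite !inE -?andbA //.
  by rewrite andbC -andbA.
have quE v : v \in [:: u; w] -> deg v = q v.
  move=> vuw; rewrite /deg /q /ext_deg; apply: eq_card => e; rewrite !inE.
  case eA: (adj G e.1 e.2) => //=; have eD : e \in darts G by rewrite inE eA.
  case: eqP => //= ev; apply/esym/negP => /(latext e eD).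
  by rewrite ev; move: vuw; rewrite !inE => /orP[]/eqP->; rewrite eqxx => -[].
have ext_u v : v != u -> v != w -> (q v <= q u)%N.
  by move=> vu vw; have := umax v isT; rewrite /= (qE v vu vw) quE //; lia.
have ext_w v : v != u -> v != w -> (q v <= q w)%N.
  by move=> vu vw; have := wmax v vu; rewrite /= (qE v vu vw) quE //; lia.
have part := faces_partition GS GR.
have sinj F : F \in faces G -> {in F &, injective (@snd V V)} := face_snd_inj G_ang (F:=F).
have [B [B0 Bs Ble Blt]] := labelling part sinj (fun F H => card_face G_ang H) ext2 lat2
  latext uw ext_u ext_w (ltnW k_gt2) t_large.
have k0 : (0 < k)%N by lia.
have t0 : (0 < t)%N.
  by rewrite lt0n; apply: contraTneq t_large => ->; rewrite mulr0 ltr10.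
have r0 := theta_radius_gt0 R k t0.
have [x [xW <- _]] := spectral_radius_max R (face_hypergraph G) k0 (ltnW (ltnW V2)).
have HE : face_hypergraph G = [set snd @: (F : {set V * V}) | F in faces G].
  by apply: eq_in_imset => F FF; exact: (face_vertices_snd GS GR FF).
have [x0 x1] := xW.
have le_form := hypergraph_form_imset_le k sinj x0.
rewrite HE; split.
  apply: le_trans le_form _; apply: (corner_form_le (B := B) part) => //.
  - exact: card_face G_ang.
  - by move=> e eF; rewrite theta_radiusX //; exact: Ble.
(* Either the weights are strict, or q(u) = q(w) = t. Then [u] and [w] lie on all faces and no
   extremal corner is left elsewhere, so the other vertices have degree 2. *)
have [qlt|qge] := ltnP (q u + q w)%N (2 * t)%N.
  left; apply: le_lt_trans le_form _; apply: (corner_form_lt (B := B) part) => //.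
  - exact: card_face G_ang.
  - by move=> e eF; rewrite theta_radiusX //; exact: Blt.
right; exists u, w; split=> //.
  (* The t extremal corners at [v] lie in t different faces, hence in all of them. *)
  have qut v : q v = t -> forall F, F \in faces G -> v \in face_vertices F.
    move=> qv F FF; have : pblock (faces G) @: [set e in darts G | e.2 == v] = faces G.
      apply/eqP; rewrite eqEcard; apply/andP; split.
        apply/subsetP=> _ /imsetP[e eD ->]; move: eD; rewrite inE => /andP[eD _].
        by have [] := corner_block part eD.
      rewrite [leqRHS]card_in_imset.
        apply: (@leq_trans (q v)); first by rewrite qv.
        apply/subset_leq_card/subsetP => e.
        by rewrite !inE => /and3P[-> ->].
      move=> e d; rewrite ![_ \in [set _ in _ | _]]inE => /andP[eD /eqP ev] /andP[dD /eqP dv] E.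
      have [pP ep] := corner_block part eD; have [_ dp] := corner_block part dD.
      by rewrite -E in dp; apply: (sinj _ pP) => //; rewrite ev dv.
    move/setP/(_ F); rewrite FF => /imsetP[e]; rewrite inE => /andP[eD /eqP ev] FE.
    have [_ ep] := corner_block part eD; rewrite (face_vertices_snd GS GR FF) FE.
    by apply/imsetP; exists e.
  have qu := ext_deg_le lat part sinj u; have qw := ext_deg_le lat part sinj w.
  rewrite -/q in qu qw; move=> F FF; split; apply: qut => //;
    move: qge qu qw; move: (q u) (q w) #|faces G|; clear; lia.
move=> v vu vw; rewrite -card_in_darts -/(deg v) qE //.
have := ext_deg_other snd part ext2 uw vu vw; rewrite -/q.
move: qge; move: (q u) (q w) (q v) #|faces G|; clear; lia.
Qed.

End AngulationRadius.

Local Close Scope ring_scope.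

(** * Lower bound for balanced theta hypergraphs *)

Section ThetaRadius.
Variables (R : realType) (V : finType) (t k : nat) (p : 'I_t -> nat) (H : {set {set V}}).
Hypotheses (p_bal : balanced p k) (H_iso : hypergraph_iso (face_hypergraph (theta p)) H).

Lemma theta_iso_count : (k - 2) * t = 2 * (#|V| - 2) /\ 3 <= t.
Proof.
have [f f_bij _] := H_iso; have E := bij_eq_card f_bij.
rewrite card_theta_vertex in E; have := sum_theta_lengths p_bal.
by case: p_bal => t3 _ _; split=> //; lia.
Qed.

Lemma theta_iso_radius : (theta_radius R k t <= spectral_radius R k H)%R.
Proof.
have [count t3] := theta_iso_count; have [f f_bij HE] := H_iso.
have f_inj : injective f := bij_inj f_bij.
have cH : #|H| = t.
  rewrite HE card_imset; last exact: imset_inj.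
  by rewrite (theta_face_hypergraph p_bal) card_imset ?card_ord //; exact: theta_face_inj p_bal.
have V2 : 2 < #|V|.
  have := bij_eq_card f_bij; rewrite card_theta_vertex => <-.
  rewrite -addn1 leq_add2l; pose i : 'I_t := Ordinal (leq_trans (isT : 0 < 3) t3).
  by case: p_bal => _ /(_ i) p0 _; rewrite (bigD1 i) //=; lia.
have k0 : 0 < k by lia.
rewrite -{1}cH; apply: (@theta_radius_lower R V k k0 H (f (inl false)) (f (inl true))) => //.
- by rewrite (inj_eq f_inj).
- move=> e; rewrite HE (theta_face_hypergraph p_bal) => /imsetP[_ /imsetP[i _ ->] ->].
  by rewrite card_imset // (card_theta_face p_bal) !mem_imset // !inE.
- by rewrite cH.
Qed.
End ThetaRadius.

(** * Existence of a balanced theta hypergraph and the characterization *)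

Lemma angulation_count k (V : finType) (G : embedding V) : 2 < k ->
  closed_angulation G k -> (k - 2) * #|faces G| = 2 * (#|V| - 2).
Proof.
move=> k2 G_ang; have := angulation_euler G_ang; case: G_ang => _ [V2 _ _] _.
by move: #|faces G| #|V| V2 => t n n2; nia.
Qed.

Lemma exists_theta n k t : 4 <= k -> 3 <= t -> (k - 2) * t = 2 * (n - 2) -> 2 <= n ->
  exists2 H : {set {set 'I_n}}, planar_hypergraph k H &
    exists p : 'I_t -> nat, balanced p k /\ hypergraph_iso (face_hypergraph (theta p)) H.
Proof.
move=> k4 t3 E n2; pose p := @alternating_lengths k t.
have p_bal : balanced p k := alternating_balanced k4 t3 E.
have cV : #|theta_vertex p| = n.
  by rewrite card_theta_vertex; have := sum_theta_lengths p_bal; lia.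
have [f [g fK gK]] : {f : theta_vertex p -> 'I_n & {g | cancel f g & cancel g f}}.
  exists (fun x => cast_ord cV (enum_rank x)).
  by exists (fun i => enum_val (cast_ord (esym cV) i)) => x;
    rewrite ?cast_ordK ?enum_rankK ?enum_valK ?cast_ordKV.
have ang := transport_angulation fK gK (theta_angulation p_bal).
exists (face_hypergraph (transport (theta p) f g)); first by exists (transport (theta p) f g).
exists p; split=> //; exists f; first by exists g.
exact: (transport_face_hypergraph (theta p) fK gK).
Qed.

Theorem theorem1p3 (R : realType) (k : nat) (hk : 5 <= k) :
  exists N : nat, forall n : nat, N <= n -> admissible k n ->
  forall H : {set {set 'I_n}}, planar_hypergraph k H ->
    (forall H' : {set {set 'I_n}}, planar_hypergraph k H' ->
       (spectral_radius R k H' <= spectral_radius R k H)%R)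
    <->
    (exists (t : nat) (p : 'I_t -> nat),
       balanced p k /\ hypergraph_iso (face_hypergraph (theta p)) H).
Proof.
have floor_gt0 : (0 < label_floor R k ^+ k)%R.
  have k0 : (0 < k%:R :> R)%R by rewrite ltr0n; lia.
  by rewrite exprn_gt0 // /label_floor !(divr_gt0, mulr_gt0, invr_gt0).
(* Exceeding the reciprocal gives the largeness condition on t; the summand 3 also yields t >= 3. *)
pose T := (Num.truncn (label_floor R k ^+ k)^-1 + 3).
have T_large t : T <= t -> (1 < label_floor R k ^+ k * t%:R)%R.
  move=> Tt; rewrite -ltr_pdivrMl // mulr1; apply: lt_le_trans (truncnS_gt _) _.
  by rewrite ler_nat (leq_trans _ Tt) // /T addnS ltnS leq_addr.
(* From (k - 2)t = 2(n - 2) >= 2kT it follows that t >= T. *)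
exists (k * T + 2) => n n_large [_ /dvdnP[t tE]] H.
have k2 : 2 < k by lia.
have Tt : T <= t by nia.
have t3 : 3 <= t by rewrite (leq_trans _ Tt) // leq_addl.
have n2 : 2 <= n by lia.
have count (G : embedding 'I_n) : closed_angulation G k -> #|faces G| = t.
  by move=> /(angulation_count k2); rewrite card_ord; nia.
have upper (G : embedding 'I_n) (G_ang : closed_angulation G k) :=
  @angulation_radius R _ G k G_ang k2.
case=> G G_ang ->; split=> [max|[t' [p [p_bal iso]]] _ [G' G'_ang ->]].
  have E : (k - 2) * t = 2 * (n - 2) by rewrite tE mulnC.
  have [H0 H0_planar [p0 [p0_bal iso0]]] := exists_theta (ltnW hk) t3 E n2.
  (* Since some balanced theta hypergraph on ['I_n] reaches the bound, a maximal hypergraph cannot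
     stay strictly below it. *)
  have := upper G G_ang; rewrite count // => /(_ (T_large t Tt))[_ [lt|[u [w [uw all deg]]]]].
    have := le_lt_trans (le_trans (theta_iso_radius R p0_bal iso0) (max _ H0_planar)) lt.
    by rewrite ltxx.
  by apply: (theta_structure G_ang uw k2 _ all deg); rewrite count.
(* Counting vertices forces t' = t, so [H] reaches the bound that holds for every competitor. *)
have [+ _] := theta_iso_count p_bal iso; rewrite card_ord => count'.
have tt' : t' = t by nia.
have := upper G' G'_ang; rewrite count // => /(_ (T_large t Tt))[le _].
by apply: le_trans le _; rewrite -tt'; exact: theta_iso_radius p_bal iso.
Qed.
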